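(* Let $p \geqslant 11$ be a prime number. Maps are counted up to orientation-preserving isomorphism and duality. **1.** If $p \equiv -1 \bmod 5$, then there are exactly two orientably-regular maps of Euler characteristic $-2p^2$ with orientation-preserving automorphism group of order $10p^2$. These maps are reflexive. If $t_1$ and $t_2$ are the solutions of $y^2+y-1\equiv 0 \bmod p$, then the orientation-preserving automorphism group of each of them is isomorphic to $$\langle a,b,c,d : a^p=b^p=c^5=d^2=[a,b]=(da)^2=(db)^2=1,\ cac^{-1}=b^{t_2},\ cbc^{-1}=(ab)^{t_1},\ dcd=a^{t_1^2}b^2c\rangle .$$ **2.** If $p\equiv 1 \bmod 5$, then there are exactly ten orientably-regular maps of Euler characteristic $-2p^2$ with orientation-preserving automorphism group of order $10p^2$. Two of them are reflexive, and the remaining ones form four chiral pairs. The orientation-preserving automorphism group of two of these chiral pairs is isomorphic to $$\langle a,b,c : a^{p^2}=b^5=c^2=(ca)^2=[c,b]=1,\ bab^{-1}=a^k\rangle,$$ where $k$ is a primitive fifth root of unity in $\mathbb{Z}_{p^2}$; the orientation-preserving automorphism group of the other two chiral pairs is isomorphic to $$\langle a,b,c,d : a^p=b^p=c^5=d^2=[a,b]=(da)^2=(db)^2=1,\ cac^{-1}=a^s,\ cbc^{-1}=b^{s^2},\ dcd=a^{1-s}b^{1-s^2}c\rangle;$$ and the orientation-preserving automorphism group of the two reflexive ones is isomorphic to $$\langle a,b,c,d : a^p=b^p=c^5=d^2=[a,b]=(da)^2=(db)^2=1,\ cac^{-1}=a^s,\ cbc^{-1}=b^{s^4},\ dcd=a^{1-s}b^{1-s^4}c\rangle,$$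 where $s$ is a primitive fifth root of unity in $\mathbb{Z}_p$.
   Context: $\mathbb{Z}_n$ denotes the integers modulo $n$. A map $\mathscr{M}$ on a compact connected oriented surface $X$ is an embedding in $X$ of a finite connected graph whose complement is a disjoint union of topological discs, called faces. The Euler characteristic of the map is that of $X$. An automorphism of $\mathscr{M}$ is an incidence-preserving permutation of its edges, vertices and faces induced by a homeomorphism of $X$; $\mathrm{Aut}^+(\mathscr{M})$ is the group of those induced by orientation-preserving homeomorphisms. The map is orientably-regular if $\mathrm{Aut}^+(\mathscr{M})$ acts regularly on the set of arcs (edges endowed with a direction). Its type is $\{m,k\}$, where $k$ is the degree of each vertex and $m$ the size of each face. Equivalently, isomorphism classes of orientably-regular maps of type $\{m,k\}$ correspond to the finite index torsion-free normal subgroups $\Gamma$ of the triangle group $\Delta(2,m,k)=\langle y_1,y_2,y_3 : y_1^2=y_2^m=y_3^k=y_1y_2y_3=1\rangle$, with $\mathrm{Aut}^+(\mathscr{M})\cong\Delta(2,m,k)/\Gamma$. The dual map interchanges the roles of vertices and faces. An orientably-regular map is reflexive if it admits an orientation-reversing automorphism, and chiral otherwise; a chiral map $\mathscr{M}$ and its mirror image $\bar{\mathscr{M}}$ form a chiral pair (two distinct maps). *)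

(* Defs.v *)
From HB Require Import structures.
From mathcomp Require Import all_boot all_order all_algebra all_fingroup.

Set Implicit Arguments.
Unset Strict Implicit.
Unset Printing Implicit Defensive.

Import GroupScope.

(* A map on a compact connected oriented surface, encoded by its rotation
   system.  An arc is an edge with a direction, seen as leaving its initial
   vertex; [rotation] sends an arc to the next one leaving the same vertex,
   in the positive direction, and [reversal] reverses the arcs.  [reversal]
   has no fixed point, since an edge carries two arcs.  Connectedness of the
   graph is transitivity of the group generated by [rotation] and
   [reversal].  The faces, being discs, are determined by their boundary
   walks.  Every map but the one-vertex map without edges on the sphere (of
   Euler characteristic 2) is obtained. *)
Record oriented_map := OrientedMap {
  arcs : finType;
  rotation : {perm arcs};
  reversal : {perm arcs};
  reversalK : involutive reversal;
  reversal_neq : forall d, reversal d != d;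
  oriented_map_connected :
    [transitive <<[set rotation; reversal]>>, on [set: arcs] | 'P] }.

(* The walk keeping on its left the face at the left of an arc d continues
   after d with rotation^-1 (reversal d).  Products of permutations compose
   from left to right: (s * t) d = t (s d). *)
Definition face_rotation (M : oriented_map) : {perm arcs M} :=
  reversal M * (rotation M)^-1.

Definition euler_char (M : oriented_map) : int :=
  (#|porbits (rotation M)|%:Z - #|porbits (reversal M)|%:Z
   + #|porbits (face_rotation M)|%:Z)%R.

(* Two maps related by an orientation-preserving homeomorphism. *)
Definition map_iso (M N : oriented_map) : Prop :=
  exists f : arcs M -> arcs N,
    [/\ bijective f,
        forall d, f (rotation M d) = rotation N (f d)
      & forall d, f (reversal M d) = reversal N (f d)].

(* Aut^+(M), acting on arcs: the permutations of the arcs commuting with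
   [rotation] and [reversal]. *)
Definition autp (M : oriented_map) : {group {perm arcs M}} :=
  'C([set rotation M; reversal M])%G.

Definition orientably_regular (M : oriented_map) : Prop :=
  [transitive autp M, on [set: arcs M] | 'P]
  /\ (forall d : arcs M, 'C_(autp M)[d | 'P] = 1).

Definition reflexive_map (M : oriented_map) : Prop :=
  exists f : {perm arcs M},
    (forall d, f (rotation M d) = (rotation M)^-1 (f d))
    /\ (forall d, f (reversal M d) = reversal M (f d)).

Definition chiral_map (M : oriented_map) : Prop := ~ reflexive_map M.

Lemma mirror_connected (M : oriented_map) :
  [transitive <<[set (rotation M)^-1; reversal M]>>, on [set: arcs M] | 'P].
Proof.
suff -> : <<[set (rotation M)^-1; reversal M]>>
        = <<[set rotation M; reversal M]>>.
  exact: oriented_map_connected.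
apply/eqP; rewrite eqEsubset !gen_subG !subUset !sub1set.
have H1 (x y : {perm arcs M}) : x \in <<[set x; y]>>.
  by rewrite mem_gen // set21.
have H2 (x y : {perm arcs M}) : y \in <<[set x; y]>>.
  by rewrite mem_gen // set22.
by rewrite groupV !H1 !H2 /= -groupV H1.
Qed.

(* The same map on the surface with the opposite orientation. *)
Definition mirror (M : oriented_map) : oriented_map :=
  OrientedMap (@reversalK M) (@reversal_neq M) (mirror_connected M).

Lemma dual_connected (M : oriented_map) :
  [transitive <<[set face_rotation M; reversal M]>>, on [set: arcs M] | 'P].
Proof.
suff -> : <<[set face_rotation M; reversal M]>>
        = <<[set rotation M; reversal M]>>.
  exact: oriented_map_connected.
have H1 (x y : {perm arcs M}) : x \in <<[set x; y]>>.
  by rewrite mem_gen // set21.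
have H2 (x y : {perm arcs M}) : y \in <<[set x; y]>>.
  by rewrite mem_gen // set22.
apply/eqP; rewrite eqEsubset !gen_subG !subUset !sub1set !H2 !andbT.
rewrite /face_rotation groupM ?groupV ?H1 ?H2 //=.
set x := reversal M * (rotation M)^-1.
have -> : rotation M = x^-1 * reversal M by rewrite invMg invgK mulgKV.
by rewrite groupM ?groupV ?H1 ?H2.
Qed.

(* The dual arc of d leaves the face at the left of d and crosses d; it is
   identified with d.  The orientation of the surface is kept, and the next
   dual arc around that face is the one of [face_rotation M d]. *)
Definition dual (M : oriented_map) : oriented_map :=
  OrientedMap (@reversalK M) (@reversal_neq M) (dual_connected M).

(* Equivalence up to orientation-preserving isomorphism and duality; the
   double dual of N is isomorphic to N, so one dual is enough. *)
Definition map_equiv (M N : oriented_map) : Prop :=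
  map_iso M N \/ map_iso M (dual N).

(* The maps satisfying P are exactly n up to equivalence, and Ms lists one
   in each class.  The default value M0 of [nth] is never reached. *)
Definition classified (P : oriented_map -> Prop) (n : nat)
    (Ms : seq oriented_map) : Prop :=
  [/\ size Ms = n,
      forall M0 i, (i < n)%N -> P (nth M0 Ms i),
      forall M0 i j, (i < n)%N -> (j < n)%N ->
        map_equiv (nth M0 Ms i) (nth M0 Ms j) -> i = j
    & forall M0 M, P M -> exists2 i, (i < n)%N & map_equiv M (nth M0 Ms i)].

Definition regular_map_of (chi : int) (n : nat) (M : oriented_map) : Prop :=
  [/\ orientably_regular M, euler_char M = chi & #|autp M| = n].

(* Elements of 'F_p and 'Z_(p ^ 2) used as exponents stand for their least
   natural representatives.  In each of the presentations below the subgroup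
   generated by a and b (by a for the cyclic one) is finite and normal with
   finite quotient, so that the presented group is finite and [\isog Grp] is
   isomorphism with it. *)

Definition presented_irreducible (p : nat) (t1 t2 : 'F_p)
    (gT : finGroupType) (G : {group gT}) : Prop :=
  G \isog Grp ( a : b : c : d :
    a ^+ p, b ^+ p, c ^+ 5, d ^+ 2, [~ a, b], (d * a) ^+ 2, (d * b) ^+ 2,
    c * a * c^-1 = b ^+ t2, c * b * c^-1 = (a * b) ^+ t1,
    d * c * d = a ^+ (t1 ^+ 2)%R * b ^+ 2 * c ).

Definition presented_cyclic (p : nat) (k : 'Z_(p ^ 2))
    (gT : finGroupType) (G : {group gT}) : Prop :=
  G \isog Grp ( a : b : c :
    a ^+ (p ^ 2)%N, b ^+ 5, c ^+ 2, (c * a) ^+ 2, [~ c, b],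
    b * a * b^-1 = a ^+ k ).

Definition presented_split (p : nat) (s : 'F_p) (e : nat)
    (gT : finGroupType) (G : {group gT}) : Prop :=
  G \isog Grp ( a : b : c : d :
    a ^+ p, b ^+ p, c ^+ 5, d ^+ 2, [~ a, b], (d * a) ^+ 2, (d * b) ^+ 2,
    c * a * c^-1 = a ^+ s, c * b * c^-1 = b ^+ (s ^+ e)%R,
    d * c * d = a ^+ (1 - s)%R * b ^+ (1 - s ^+ e)%R * c ).

(* Main.v *)
Require Import Defs.
From HB Require Import structures.
From mathcomp Require Import all_boot all_order all_algebra all_fingroup.
From mathcomp Require Import all_solvable all_field zify ring.

Set Implicit Arguments.
Unset Strict Implicit.
Unset Printing Implicit Defensive.

Import GRing.Theory.

(** Let r and l be the rotation and the reversal of an orientably-regular map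
    as in the theorem; they generate the monodromy group, which is regular on
    the arcs and isomorphic to the group of automorphisms.  Euler's formula and
    the orders leave, up to duality, only r of order 10 and r l of order 5
    ([regular_map_of10]).  The Sylow p-subgroup P is then normal and abelian of
    order p^2, and u = r^5 l lies in it.  Write c = r^6, of order 5.  The
    relations l^2 = 1 and (r l)^5 = 1 say that r^5 inverts u and that
    the product of the conjugates of u under the powers of c is 1; since u and
    r generate the group, P is the cyclic module generated by u over
    Z[X] / (1 + X + X^2 + X^3 + X^4) = Z[zeta], with X acting as c.  So a map
    is the same thing as an ideal of norm p^2 of Z[zeta], the annihilator of u:
    the mirror image is the complex conjugate ideal, and the number of maps is
    2 or 10 according as p splits into 2 or 4 prime ideals.

    An ideal is recorded here by a [datum]: either X acts on u as a scalar k
    modulo p^2, or P has exponent p and X^2 - t X + n kills u.  Every map has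
    exactly one datum ([realizes_exists], [realizes_inj]), and the condition
    [admissible] on it is that 1 + X + X^2 + X^3 + X^4 vanishes in the
    quotient.  Conversely each admissible datum comes from a group of affine
    permutations of Z[zeta] / I ([cyc_model], [quad_model]).  Solving
    [admissible] is elementary ([phi5_roots_Zp2], [admissible_quad]): when p is
    -1 modulo 5 only t^2 + t = 1, n = 1 is possible, and when p is 1 modulo 5
    the solutions come from a primitive fifth root of unity.

    That two maps with the same datum are isomorphic, and that their groups
    have the stated presentations, rests on the same device: the relations
    bound the order of any finite group that satisfies them by 10 p^2, and so
    that of the diagonal subgroup in the product of two such groups, which is
    then the graph of an isomorphism ([diagonal_morphism], [isoGrp_card]). *)

(** * Diagonal subgroups and presented groups *)

Section Diagonal.
Local Open Scope group_scope.

Lemma expg_pair (gT rT : finGroupType) (x : gT) (y : rT) n :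
  (x, y) ^+ n = (x ^+ n, y ^+ n).
Proof. by elim: n => [|n IH] //; rewrite !expgS IH. Qed.

Lemma eval_pair (gT rT : finGroupType) (e : seq gT) (e' : seq rT)
    (t : Presentation.term) :
  size e = size e' ->
  Presentation.eval (zip e e') t
    = (Presentation.eval e t, Presentation.eval e' t).
Proof.
move=> szee'; elim: t => //=.
- by move=> n; rewrite -nth_zip.
- by move=> t ->.
- by move=> t -> n; rewrite expg_pair.
- by move=> t1 -> t2 ->.
- by move=> t1 -> t2 ->.
by move=> t1 -> t2 ->.
Qed.

Lemma fst_morphM (gT rT : finGroupType) :
  {in [set: gT * rT] &, {morph (@fst gT rT) : x y / x * y}}.
Proof. by []. Qed.

Lemma snd_morphM (gT rT : finGroupType) :
  {in [set: gT * rT] &, {morph (@snd gT rT) : x y / x * y}}.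
Proof. by []. Qed.

Definition fst_morph (gT rT : finGroupType) := Morphism (@fst_morphM gT rT).
Definition snd_morph (gT rT : finGroupType) := Morphism (@snd_morphM gT rT).

(** The induction behind the diagonal subgroup: satisfaction is defined by
    recursion on the number of generators, with an environment that holds the
    subgroup generated so far and the list of generators. *)
Lemma sat_pair (gT rT : finGroupType) (p : Presentation.type) n
    (vT vT' vT2 : finType) (s : vT -> Presentation.env gT)
    (s' : vT' -> Presentation.env rT)
    (s2 : vT2 -> Presentation.env (gT * rT)%type)
    (G : {set gT}) (H : {set rT}) :
  (forall v v', exists v2,
     let: Presentation.Env A e := s v in
     let: Presentation.Env A' e' := s' v' in
     size e = size e' /\ exists K : {group gT * rT},
       [/\ s2 v2 = Presentation.Env K (zip e e'), fst_morph gT rT @* K = A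
         & snd_morph gT rT @* K = A']) ->
  Presentation.sat G n s p -> Presentation.sat H n s' p ->
  exists K : {group gT * rT},
    [/\ Presentation.sat K n s2 p, fst_morph gT rT @* K = G
      & snd_morph gT rT @* K = H].
Proof.
have and_relE xT x1 x2 r :
  @Presentation.and_rel xT x1 x2 r = (x1 == x2) && r :> bool.
  by case: r => //=; rewrite andbT.
have relP e e' f (r1 r2 r3 : Presentation.rel_type) : size e = size e' ->
    (r1 -> r2 -> r3) -> @Presentation.rel gT e f r1 ->
    @Presentation.rel rT e' f r2 -> Presentation.rel (zip e e') f r3.
  move=> sz; elim: f r1 r2 r3 => [x1 x2|f1 IH1 f2 IH2] r1 r2 r3 /= IHr.
    rewrite !and_relE !eval_pair // => /andP[/eqP-> h1] /andP[/eqP-> h2].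
    by rewrite eqxx IHr.
  by apply: IH1; apply: IH2.
elim: p n vT vT' vT2 s s' s2
  => /= [p IHp | f] n vT vT' vT2 s s' s2 inv; last first.
  case/existsP=> v Hv /existsP[v' Hv']; have [v2] := inv v v'.
  case: (s v) (s' v') Hv Hv' => A e [A' e'].
  rewrite !and_relE => /andP[/eqP defA re] /andP[/eqP defA' re'].
  case=> sz [K [Ds2 fK sK]]; exists K; rewrite fK sK; split=> //.
  apply/existsP; exists v2; rewrite Ds2 and_relE eqxx /= rev_zip //.
  by apply: relP re re'; rewrite ?size_rev.
apply: IHp => [[v x] [v' x']] /=; have [v2] := inv v v'.
case: (s v) (s' v') => A e [A' e'] [sz [K [Ds2 fK sK]]].
exists (v2, (x, x')) => /=; split; first by rewrite sz.
exists (K <*> <[(x, x')]>)%G; rewrite Ds2 /=.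
by rewrite !morphimY ?subsetT // fK sK !morphim_cycle ?inE.
Qed.

Lemma homGrp_pair (gT rT : finGroupType) (G : {group gT}) (H : {group rT}) p :
    G \homg Grp p -> H \homg Grp p ->
  exists K : {group gT * rT},
    [/\ K \homg Grp p, fst_morph gT rT @* K = G & snd_morph gT rT @* K = H].
Proof.
apply: sat_pair => v v'; exists (v, v') => /=; split=> //; exists <[(v, v')]>%G.
by rewrite !morphim_cycle ?inE.
Qed.

(** A finite group of the largest order among those satisfying a presentation
    is the presented one: in its product with any other one H, the diagonal
    subgroup on corresponding generators satisfies the presentation too, hence
    is no larger, so that its projection to the first factor is bijective and
    the other projection makes H a quotient. *)
Lemma isoGrp_card (gT : finGroupType) (G : {group gT}) p :
    G \homg Grp p ->
    (forall (rT : finGroupType) (H : {group rT}), H \homg Grp p ->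
       #|H| <= #|G|) ->
  G \isog Grp p.
Proof.
move=> Gp maxG; apply: intro_isoGrp => // rT H Hp.
have [K [Kp fK sK]] := homGrp_pair Gp Hp.
have isoK : G \isog K.
  by rewrite isogEcard maxG // andbT -fK morphim_homg ?subsetT.
by rewrite (eq_homgr _ isoK) -sK morphim_homg ?subsetT.
Qed.

(** If the diagonal subgroup is no larger than its projection to the first
    factor, it is the graph of a morphism. *)
Lemma diagonal_morphism (gT rT : finGroupType) (r l : gT) (r' l' : rT) :
    #|<<[set (r, r'); (l, l')]>>| <= #|<<[set r; l]>>| ->
  exists f : {morphism <<[set r; l]>> >-> rT}, f r = r' /\ f l = l'.
Proof.
set K := <<_>> => leK.
have fK : fst_morph gT rT @* K = <<[set r; l]>>.
  rewrite morphim_gen ?subsetT //; congr (<<_>>).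
  by rewrite morphimEsub ?subsetT // imsetU !imset_set1.
have injf : 'injm (restrm (subsetT K) (fst_morph gT rT)).
  rewrite -card_im_injm eqn_leq morphim_restrm setIid fK leK andbT.
  by rewrite -fK leq_morphim.
have imf : restrm (subsetT K) (fst_morph gT rT) @* K = <<[set r; l]>>.
  by rewrite morphim_restrm setIid.
have Kr : (r, r') \in K by rewrite mem_gen ?set21.
have Kl : (l, l') \in K by rewrite mem_gen ?set22.
pose g := snd_morph gT rT \o invm injf.
have sG : <<[set r; l]>> \subset 'dom g.
  by rewrite /dom /= /invm /= -imf; apply/subsetP => x; rewrite !inE => ->.
have gr : invm injf r = (r, r') := invmE injf Kr.
have gl : invm injf l = (l, l') := invmE injf Kl.
exists (restrm_morphism sG [morphism of g]); split.
  by change (snd (invm injf r) = r'); rewrite gr.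
by change (snd (invm injf l) = l'); rewrite gl.
Qed.
End Diagonal.

(** * Monodromy groups of orientably-regular maps *)

Section Maps.
Local Open Scope group_scope.
Implicit Types M N : oriented_map.

Definition monodromy M := <<[set rotation M; reversal M]>>%G.

Lemma monodromy_rot M : rotation M \in monodromy M.
Proof. by rewrite mem_gen ?set21. Qed.

Lemma monodromy_rev M : reversal M \in monodromy M.
Proof. by rewrite mem_gen ?set22. Qed.

Lemma monodromy_connected M (d e : arcs M) :
  exists2 g, g \in monodromy M & e = g d.
Proof.
have [g Gg ->] :=
  atransP2 (@oriented_map_connected M) (in_setT d) (in_setT e).
by exists g.
Qed.

Lemma autp_commute M h g d :
  h \in autp M -> g \in monodromy M -> h (g d) = g (h d).
Proof.
move=> Ah Gg; have /centP/(_ g Gg) : h \in 'C(monodromy M) by rewrite cent_gen.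
by move/permP/(_ d); rewrite !permM => ->.
Qed.

(** An automorphism moving d to e carries a fixed point d of g to a fixed point
    e, as the two groups commute. *)
Lemma monodromy_free M : orientably_regular M ->
  forall g d, g \in monodromy M -> g d = d -> g = 1.
Proof.
case=> [tr _] g d Gg gd; apply/permP => e; rewrite perm1.
have [h Ah ->] := atransP2 tr (in_setT d) (in_setT e).
by rewrite /= apermE -autp_commute // gd.
Qed.

Lemma autp_free M h d : h \in autp M -> h d = d -> h = 1.
Proof.
move=> Ah hd; apply/permP => e; rewrite perm1.
by have [g Gg ->] := monodromy_connected d e; rewrite autp_commute // hd.
Qed.

Lemma card_monodromy M : orientably_regular M -> #|monodromy M| = #|autp M|.
Proof.
move=> rM; have [tr _] := rM; have /imsetP[d _ _] := tr.
have inG : {in monodromy M &, injective (fun g : {perm arcs M} => g d)}.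
  move=> g h Gg Gh /= e; apply/eqP; rewrite eq_sym eq_mulgV1; apply/eqP.
  by apply: (monodromy_free rM (d := d)); rewrite ?groupM ?groupV // permM -e permK.
have inA : {in autp M &, injective (fun g : {perm arcs M} => g d)}.
  move=> g h Gg Gh /= e; apply/eqP; rewrite eq_sym eq_mulgV1; apply/eqP.
  by apply: (autp_free (d := d)); rewrite ?groupM ?groupV // permM -e permK.
rewrite -(card_in_imset inG) -(card_in_imset inA); apply: eq_card => e.
have [g Gg eg] := monodromy_connected d e.
have [h Ah eh] := atransP2 tr (in_setT d) (in_setT e).
by rewrite {1}eg eh !imset_f // -eg.
Qed.

Lemma card_arcs M : orientably_regular M -> #|arcs M| = #|autp M|.
Proof.
case=> tr st; have /imsetP[d _ Dd] := tr.
by rewrite -cardsT Dd -(card_orbit_stab 'P _ d) st cards1 muln1.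
Qed.

Lemma card_porbits_monodromy M g : orientably_regular M ->
  g \in monodromy M -> (#|porbits g| * #[g] = #|arcs M|)%N.
Proof.
move=> rM Gg; pose P := orbit 'P <[g]> @: [set: arcs M].
have sub : <[g]> \subset monodromy M by rewrite cycle_subG.
have pP : partition P [set: arcs M].
  by apply: orbit_partition; apply/actsP => h _ d; rewrite !inE.
have -> : porbits g = P.
  by rewrite /P /porbits; apply/setP => X; apply/imsetP/imsetP => -[d _ ->];
    exists d; rewrite ?porbitE ?inE.
rewrite -cardsT; symmetry; apply: card_uniform_partition pP.
move=> _ /imsetP[d _ ->]; rewrite -(muln1 #|_|) orderE.
rewrite -(card_orbit_stab 'P _ d); congr (_ * _)%N; apply/eqP.
rewrite eq_sym -trivg_card1 -subG1; apply/subsetP => h /setIP[gh /astab1P hd].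
apply/set1P; apply: (monodromy_free rM (d := d)) => //.
exact: (subsetP sub).
Qed.

(** Of two regular permutation groups centralizing each other, matching the
    elements that agree on a base arc is an anti-isomorphism; matching g with
    the automorphism that acts there as g^-1 is an isomorphism. *)
Lemma autp_isog M : orientably_regular M -> autp M \isog monodromy M.
Proof.
move=> rM; have [tr _] := rM; have /imsetP[d _ _] := tr.
have exh (g : {perm arcs M}) :
    exists h : {perm arcs M}, (h \in autp M) && (h d == g^-1 d).
  have [h Ah eh] := atransP2 tr (in_setT d) (in_setT (g^-1 d)).
  by exists h; rewrite Ah eh /=.
pose f (g : {perm arcs M}) : {perm arcs M} := xchoose (exh g).
have fA g : f g \in autp M by have /andP[] := xchooseP (exh g).
have fd g : f g d = g^-1 d by have /andP[_ /eqP] := xchooseP (exh g).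
have inA h h' : h \in autp M -> h' \in autp M -> h d = h' d -> h = h'.
  move=> Gg Gh /= e; apply/eqP; rewrite eq_sym eq_mulgV1; apply/eqP.
  by apply: (autp_free (d := d)); rewrite ?groupM ?groupV // permM -e permK.
have fM : {in monodromy M &, {morph f : g h / g * h}}.
  move=> g h Gg Gh; apply: inA; rewrite ?groupM ?fA //.
  by rewrite fd permM fd autp_commute ?groupV ?fA // fd invMg permM.
pose fm := Morphism fM.
have injf : 'injm fm.
  apply/injmP => g h Gg Gh /= e; have := fd g; rewrite e fd => hg.
  apply/eqP; rewrite -[g == h]/(_ == _) eq_mulgV1; apply/eqP.
  apply: (monodromy_free rM (d := g^-1 d)); rewrite ?groupM ?groupV //.
  by rewrite permM permKV -hg.
have imf : fm @* monodromy M = autp M.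
  apply/eqP; rewrite eqEcard card_injm // card_monodromy // leqnn andbT.
  by apply/subsetP => _ /morphimP[g _ _ ->].
by rewrite isog_sym; apply/isogP; exists fm.
Qed.

Lemma reversalV M : (reversal M)^-1 = reversal M.
Proof.
by apply/permP => d; apply: (canLR (permK _)); rewrite reversalK.
Qed.

(** Reversing every arc identifies the double dual with the map itself. *)
Lemma map_iso_dualK M : map_iso M (dual (dual M)).
Proof.
exists (reversal M); split=> [|d|d] //=.
  by exists (reversal M); apply: reversalK.
by rewrite /face_rotation /= /face_rotation invMg invgK reversalV !permM reversalK.
Qed.

Lemma map_iso_trans M N K : map_iso M N -> map_iso N K -> map_iso M K.
Proof.
case=> f [bf f1 f2] [g [bg g1 g2]]; exists (g \o f); split=> [|d|d] /=.
- exact: bij_comp.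
- by rewrite f1 g1.
by rewrite f2 g2.
Qed.

Lemma map_iso_face M N (f : arcs M -> arcs N) :
  (forall d, f (rotation M d) = rotation N (f d)) ->
  (forall d, f (reversal M d) = reversal N (f d)) ->
  forall d, f (face_rotation M d) = face_rotation N (f d).
Proof.
move=> f1 f2 d; rewrite /face_rotation !permM -f2.
by apply: (canRL (permK _)); rewrite -f1 permKV.
Qed.

Lemma map_iso_dual M N : map_iso M N -> map_iso (dual M) (dual N).
Proof.
case=> f [bf f1 f2]; exists f; split=> //=.
exact: map_iso_face.
Qed.

Lemma map_iso_morphism M N : map_iso M N ->
  exists f : {morphism [set: {perm arcs M}] >-> {perm arcs N}},
    [/\ 'injm f, f (rotation M) = rotation N & f (reversal M) = reversal N].
Proof.
case=> f [[f' fK f'K] f1 f2].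
have inj (g : {perm arcs M}) : injective (fun e => f (g (f' e))).
  move=> e1 e2 /(can_inj fK) /perm_inj; exact: (can_inj f'K).
have gM : {in [set: {perm arcs M}] &,
    {morph (fun g => perm (inj g)) : g h / g * h}}.
  by move=> g h _ _ /=; apply/permP => e; rewrite permM !permE /= fK.
exists (Morphism gM); split.
- apply/injmP => g h _ _ /= /permP eq_gh; apply/permP => d.
  by have := eq_gh (f d); rewrite !permE fK => /(can_inj fK).
- by apply/permP => e; rewrite /= permE f1 f'K.
by apply/permP => e; rewrite /= permE f2 f'K.
Qed.

(** A morphism between regular permutation groups induces a map between the
    permuted sets, by transport from base points. *)
Lemma morphism_map_iso M N
    (f : {morphism monodromy M >-> {perm arcs N}}) :
    orientably_regular M -> orientably_regular N ->
    #|arcs M| = #|arcs N| ->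
    f (rotation M) = rotation N -> f (reversal M) = reversal N ->
  map_iso M N.
Proof.
move=> rM rN eMN f1 f2.
have [tr _] := rM; have /imsetP[d _ _] := tr.
have [trN _] := rN; have /imsetP[e _ _] := trN.
have exg x : exists g : {perm arcs M}, (g \in monodromy M) && (x == g d).
  by have [g Gg ->] := monodromy_connected d x; exists g; rewrite Gg eqxx.
pose F x := f (xchoose (exg x)) e.
have FE g : g \in monodromy M -> F (g d) = f g e.
  move=> Gg; rewrite /F; have /andP[] := xchooseP (exg (g d)).
  set h := xchoose _ => Gh /eqP hd; congr (f _ e).
  apply/eqP; rewrite eq_sym eq_mulgV1; apply/eqP.
  by apply: (monodromy_free rM (d := d)); rewrite ?groupM ?groupV // permM hd permK.
have Fc (s : {perm arcs M}) x : s \in monodromy M -> F (s x) = f s (F x).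
  move=> Gs; have [g Gg ->] := monodromy_connected d x.
  by rewrite -permM !FE ?groupM // morphM // permM.
have surj y : exists x, F x = y.
  have [g Gg ->] := monodromy_connected e y.
  have fG : f @* monodromy M = monodromy N.
    rewrite morphim_gen ?subset_gen //; congr (<<_>>).
    by rewrite morphimEsub ?subset_gen // imsetU !imset_set1 f1 f2.
  by move: Gg; rewrite -fG => /morphimP[h _ Gh ->]; exists (h d); rewrite FE.
exists F; split=> [|x|x]; last 2 first.
- by rewrite Fc ?monodromy_rot // f1.
- by rewrite Fc ?monodromy_rev // f2.
apply: inj_card_bij; last by rewrite eMN.
have sF : #|codom F| = #|arcs N|.
  by apply: eq_card => y; rewrite inE; have [x <-] := surj y; apply: codom_f.
have /image_injP inF : #|codom F| == #|arcs M| by rewrite sF eMN.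
by move=> x y; apply: inF.
Qed.

Lemma reflexive_mirror M : reflexive_map M <-> map_iso M (mirror M).
Proof.
split=> [[f [f1 f2]]|[f [bf f1 f2]]].
  by exists f; split=> //; apply: injF_bij; apply: perm_inj.
have gE d : perm (bij_inj bf) d = f d by rewrite permE.
by exists (perm (bij_inj bf)); split=> d; rewrite !gE ?f1 ?f2.
Qed.

(** The arcs of a map with monodromy group G acting regularly may be taken to
    be the elements of G, on which the left multiplications are the
    automorphisms. *)
Lemma regular_map_exists (gT : finGroupType) (r l : gT) :
    l ^+ 2 = 1 -> l != 1 ->
  exists M, [/\ orientably_regular M, #|autp M| = #|<<[set r; l]>>|
    & exists f : {morphism <<[set r; l]>> >-> {perm arcs M}},
        [/\ 'injm f, f r = rotation M & f l = reversal M]].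
Proof.
move=> l2 l1; pose G := <<[set r; l]>>%G; pose A := subg_of G.
have Gr : r \in G by rewrite mem_gen ?set21.
have Gl : l \in G by rewrite mem_gen ?set22.
pose R (x : gT) := actperm 'R (subg G x) : {perm A}.
have RE x y : R x y = y * subg G x by rewrite actpermE.
have RM : {in G &, {morph R : x y / x * y}}.
  by move=> x y Gx Gy /=; apply/permP => z; rewrite permM !RE subgM // mulgA.
pose f := Morphism RM.
have injf : 'injm f.
  apply/injmP => x y Gx Gy /permP/(_ 1); rewrite !RE !mul1g.
  exact: (can_in_inj (@subgK _ G)).
have lK : involutive (R l).
  by move=> x; rewrite -permM -[R l]/(f l) -morphM // -[l * l]/(l ^+ 2) l2 morph1 perm1.
have ln (x : A) : R l x != x.
  apply: contra_neq l1 => /eqP; rewrite RE -{2}[x]mulg1 (inj_eq (mulgI x)) => /eqP e.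
  by have := @subgK _ G l Gl; rewrite e /= => <-.
have imf : f @* G = <<[set R r; R l]>>.
  rewrite morphim_gen ?subset_gen //; congr (<<_>>).
  by rewrite morphimEsub ?subset_gen // imsetU !imset_set1.
have tr : [transitive <<[set R r; R l]>>, on [set: A] | 'P].
  rewrite -imf; apply/imsetP; exists 1; rewrite ?inE //; apply/setP => y.
  rewrite inE; apply/esym/orbitP; exists (f (sgval y)).
    exact/mem_morphim/subgP/subgP.
  by rewrite /= apermE RE mul1g sgvalK.
exists (OrientedMap lK ln tr); set M := OrientedMap _ _ _.
have LE (y x : A) : perm (mulgI y) x = y * x by rewrite permE.
have transA : [transitive autp M, on [set: A] | 'P].
  apply/imsetP; exists 1; rewrite ?inE //; apply/setP => y.
  rewrite inE; apply/esym/orbitP; exists (perm (mulgI y)).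
    apply/centP => z zS; apply/permP => x.
    by case/set2P: zS => ->; rewrite /= !permM !LE !RE mulgA.
  by rewrite /= apermE LE mulg1.
have rM : orientably_regular M.
  split=> // d; apply/trivgP/subsetP => h /setIP[Ah /astab1P hd].
  by apply/set1P; apply: autp_free hd.
split=> //; last by exists f.
by rewrite -card_arcs // -(card_injm (injm_subg G) (subxx G)) im_subg -cardsT.
Qed.

(** Counting vertices, edges and faces turns Euler's formula into
    1/k + 1/m = 3/10, whose solutions are {5, 10} and {4, 20}. *)
Lemma type_arithmetic (q V E F k m : nat) :
    odd q -> (V * k = 10 * q)%N -> (E * 2 = 10 * q)%N -> (F * m = 10 * q)%N ->
    (V + F + 2 * q = E)%N ->
  (k = 10%N /\ m = 5%N) \/ (k = 5%N /\ m = 10%N).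
Proof.
move=> oq Vk E2 Fm VFE.
have q0 : (0 < q)%N by lia.
have VF : (V + F = 3 * q)%N by lia.
have km : (3 * (k * m) = 10 * (k + m))%N.
  apply/eqP; rewrite -(eqn_pmul2l q0); apply/eqP.
  have -> : (q * (3 * (k * m)) = V * k * m + F * m * k)%N.
    by transitivity ((V + F) * (k * m))%N; [rewrite VF|]; nia.
  by rewrite Vk Fm; nia.
have k0 : (0 < k)%N by case: (k) Vk => //; lia.
have m0 : (0 < m)%N by case: (m) Fm => //; lia.
(* a degree or face size 4 would make 4 a divisor of 10 q *)
have no4 (X : nat) : (X * 4 = 10 * q)%N -> False by lia.
have aux (a b X : nat) : (a <= b)%N -> (0 < a)%N ->
    (3 * (a * b) = 10 * (a + b))%N -> (X * a = 10 * q)%N ->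
    a = 5%N /\ b = 10%N.
  move=> leab a0 ab Xa; have ale : (a <= 6)%N by nia.
  have age : (4 <= a)%N by nia.
  have [a4|[a5|a6]] : a = 4%N \/ a = 5%N \/ a = 6%N by lia.
  - by case: (no4 X); rewrite -Xa a4.
  - by lia.
  by lia.
have [le|/ltnW le] := leqP k m.
  by right; apply: aux Vk.
left; have [|-> ->] := aux m k F le m0 _ Fm; last by split.
by rewrite mulnC addnC mulnC (mulnC m).
Qed.

(** The maps to be classified, taken up to duality with vertices of degree 10,
    hence with faces of size 5. *)
Definition regular_map10 p M :=
  [/\ orientably_regular M, #|autp M| = (10 * p ^ 2)%N, #[rotation M] = 10%N
    & (rotation M * reversal M) ^+ 5 = 1].

Lemma face_rotationV M : (face_rotation M)^-1 = rotation M * reversal M.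
Proof. by rewrite invMg invgK reversalV. Qed.

Lemma order_reversal M (d : arcs M) : #[reversal M] = 2%N.
Proof.
apply: nt_prime_order => //.
  by rewrite expgS expg1 -{2}reversalV mulgV.
by apply/eqP => /permP/(_ d)/eqP; rewrite perm1; apply/negP/reversal_neq.
Qed.

Lemma order_face M (d : arcs M) : #[rotation M] = 10%N ->
  (rotation M * reversal M) ^+ 5 = 1 -> #[face_rotation M] = 5%N.
Proof.
move=> o10 rl5; rewrite -orderV face_rotationV; apply: nt_prime_order => //.
apply/eqP => rl; have : #[rotation M] = 2%N.
  by rewrite -(order_reversal d) -[RHS]orderV -(mulgK (reversal M) (rotation M)) rl mul1g.
by rewrite o10.
Qed.

Lemma regular_arc M : orientably_regular M -> exists d : arcs M, true.
Proof. by case=> /imsetP[d]; exists d. Qed.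

(** In a regular permutation group all the orbits of an element have its order
    as length. *)
Lemma euler_char_regular n M : orientably_regular M -> #|autp M| = n ->
  exists V E F, [/\ (V * #[rotation M] = n)%N, (E * 2 = n)%N,
    (F * #[face_rotation M] = n)%N
    & euler_char M = (V%:Z - E%:Z + F%:Z)%R].
Proof.
move=> rM <-; have [d _] := regular_arc rM; rewrite -card_arcs //.
exists #|porbits (rotation M)|, #|porbits (reversal M)|,
  #|porbits (face_rotation M)|; split=> //.
- by rewrite card_porbits_monodromy // monodromy_rot.
- by rewrite -(order_reversal d) card_porbits_monodromy // monodromy_rev.
by rewrite card_porbits_monodromy // groupM ?groupV ?monodromy_rot ?monodromy_rev.
Qed.

Lemma regular_map10_of p M : regular_map10 p M ->
  regular_map_of (- (2 * p ^ 2)%:Z)%R (10 * p ^ 2) M.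
Proof.
case=> rM cM o10 rl5; split=> //; have [d _] := regular_arc rM.
have [V [E [F [hV hE hF ->]]]] := euler_char_regular rM cM.
move: hV hF; rewrite o10 (order_face d) // => hV hF.
lia.
Qed.

Lemma autp_dual M : autp (dual M) = autp M :> {set _}.
Proof.
rewrite /autp /= -cent_gen -[RHS]cent_gen; congr 'C(_).
apply/eqP; rewrite eqEsubset !gen_subG !subUset !sub1set.
have H1 (x y : {perm arcs M}) : x \in <<[set x; y]>> by rewrite mem_gen // set21.
have H2 (x y : {perm arcs M}) : y \in <<[set x; y]>> by rewrite mem_gen // set22.
rewrite !H2 !andbT /face_rotation groupM ?groupV ?H1 ?H2 //=.
set x := reversal M * (rotation M)^-1.
have -> : rotation M = x^-1 * reversal M by rewrite invMg invgK mulgKV.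
by rewrite groupM ?groupV ?H1 ?H2.
Qed.

Lemma autp_mirror M : autp (mirror M) = autp M :> {set _}.
Proof.
rewrite /autp /= -cent_gen -[RHS]cent_gen; congr 'C(_).
apply/eqP; rewrite eqEsubset !gen_subG !subUset !sub1set.
have H1 (x y : {perm arcs M}) : x \in <<[set x; y]>> by rewrite mem_gen // set21.
have H2 (x y : {perm arcs M}) : y \in <<[set x; y]>> by rewrite mem_gen // set22.
by rewrite !H2 !andbT groupV H1 -groupV H1.
Qed.

Lemma dual_regular M : orientably_regular M -> orientably_regular (dual M).
Proof. by rewrite /orientably_regular -/(arcs (dual M)) autp_dual. Qed.

Lemma mirror_regular M : orientably_regular M -> orientably_regular (mirror M).
Proof. by rewrite /orientably_regular autp_mirror. Qed.

Lemma regular_map_of10 p M : odd p ->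
    regular_map_of (- (2 * p ^ 2)%:Z)%R (10 * p ^ 2) M ->
  regular_map10 p M \/ regular_map10 p (dual M).
Proof.
move=> op [rM ec cM].
have [V [E [F [hV hE hF eq_ec]]]] := euler_char_regular rM cM.
have [||[k10 m5]|[k5 m10]] := type_arithmetic _ hV hE hF.
- by rewrite oddX op orbT.
- by move: ec; rewrite eq_ec; lia.
- left; split=> //; rewrite -face_rotationV expgVn.
  by rewrite -m5 expg_order invg1.
right; split=> //; first exact: dual_regular.
- by rewrite autp_dual.
rewrite /= -[X in X * _]invgK face_rotationV invMg reversalV.
rewrite -{1}reversalV -mulgA -conjgE -conjXg.
by rewrite expgVn -k5 expg_order invg1 conj1g.
Qed.

Lemma regular_map10_mirror p M : regular_map10 p M -> regular_map10 p (mirror M).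
Proof.
case=> rM cM o10 rl5; split=> //; first exact: mirror_regular.
- by rewrite autp_mirror.
- by rewrite /= orderV.
rewrite /= -[reversal M]reversalV -invMg expgVn; apply/eqP; rewrite invg_eq1.
have -> : reversal M * rotation M = (rotation M * reversal M) ^ rotation M.
  by rewrite conjgE mulgA mulKg.
by rewrite -conjXg rl5 conj1g.
Qed.

Lemma regular_map10_dual_iso p M N : regular_map10 p M -> regular_map10 p N ->
  ~ map_iso M (dual N).
Proof.
case=> rM cM o10 _ [rN cN o10' rl5] /map_iso_morphism[f [injf fr _]].
have /imsetP[d _ _] := rN.1.
have := order_injm injf (in_setT (rotation M)).
by rewrite fr /= (order_face d) // o10.
Qed.
End Maps.

(** * The datum of a pair of generators *)

Section Exponents.
Local Open Scope group_scope.
Variables (gT : finGroupType) (n q : nat) (Dq : (Zp_trunc n).+2 = q).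
Implicit Types (x : gT) (a b : 'Z_n).

Lemma expgZ_mod x (m : nat) : x ^+ q = 1 -> x ^+ (m %% (Zp_trunc n).+2) = x ^+ m.
Proof. by move=> xq; rewrite Dq expg_mod. Qed.

Lemma expgZD x a b : x ^+ q = 1 -> x ^+ (a + b)%R = x ^+ a * x ^+ b.
Proof. by move=> xq; rewrite /= expgZ_mod // expgD. Qed.

Lemma expgZM x a b : x ^+ q = 1 -> x ^+ (a * b)%R = x ^+ a ^+ b.
Proof. by move=> xq; rewrite /= expgZ_mod // expgM. Qed.

Lemma expgZN x a : x ^+ q = 1 -> x ^+ (- a)%R = (x ^+ a)^-1.
Proof.
move=> xq; apply: (mulIg (x ^+ a)).
by rewrite -expgZD // GRing.addNr mulVg.
Qed.

Lemma expgZ_nat x (m : nat) : x ^+ q = 1 -> x ^+ (m%:R : 'Z_n)%R = x ^+ m.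
Proof.
move=> xq; elim: m => [|m IH] //.
by rewrite GRing.mulrSr expgZD // IH [RHS]expgSr.
Qed.

End Exponents.

(** Codes for ideals of Z[zeta]: the one generated by p^2 and zeta - k, and the
    one generated by p and zeta^2 - t zeta + n. *)
Inductive datum (p : nat) := Cyc of 'Z_(p ^ 2) | Quad of 'F_p & 'F_p.

Section Realization.
Local Open Scope group_scope.
Variables (p : nat).

(** The generator u of the Sylow p-subgroup is r^5 l, and zeta acts on it as
    the conjugation by r^6. *)
Definition realizes (d : datum p) (gT : finGroupType) (r l : gT) : Prop :=
  let u := r ^+ 5 * l in let w := u ^ (r ^+ 6) in
  match d with
  | Cyc k => u ^+ (p ^ 2) = 1 /\ w = u ^+ k
  | Quad t n =>
    [/\ u ^+ p = 1, commute u w & w ^ (r ^+ 6) = w ^+ t * u ^+ (- n)%R]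
  end.

Lemma morph_realizes d (aT rT : finGroupType) (D : {group aT})
    (f : {morphism D >-> rT}) (r l : aT) :
  r \in D -> l \in D -> realizes d r l -> realizes d (f r) (f l).
Proof.
move=> Dr Dl; rewrite /realizes -!morphX // -morphM ?groupX //.
have: r ^+ 5 * l \in D by rewrite groupM ?groupX.
move: (r ^+ 5 * l) => u Du; rewrite -morphJ ?groupX //.
have: u ^ (r ^+ 6) \in D by rewrite groupJ ?groupX.
move: (u ^ _) => w Dw; case: d => [k [u1 ->]|t n [u1 cuw wE]].
  by rewrite -!morphX // u1 morph1.
split; first by rewrite -morphX // u1 morph1.
  by rewrite /commute -!morphM // cuw.
by rewrite -morphJ ?groupX // wE -!morphX // -morphM ?groupX.
Qed.

Lemma realizes_pair d (aT rT : finGroupType) (r l : aT) (r' l' : rT) :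
  realizes d r l -> realizes d r' l' -> realizes d (r, r') (l, l').
Proof.
rewrite /realizes; cbv zeta.
have pairM (x y : aT) (x' y' : rT) : (x, x') * (y, y') = (x * y, x' * y') by [].
have pairJ (x y : aT) (x' y' : rT) : (x, x') ^ (y, y') = (x ^ y, x' ^ y') by [].
rewrite (expg_pair r r' 5) (expg_pair r r' 6) pairM.
move: (r ^+ 5 * l) (r' ^+ 5 * l') (r ^+ 6) (r' ^+ 6) => u u' c c'.
rewrite (pairJ u c u' c'); move: (u ^ c) (u' ^ c') => w w'.
case: d => [k [u1 ->] [u1' ->]|t n [u1 cuw wE] [u1' cuw' wE']].
  by rewrite !(expg_pair u u') u1 u1'.
rewrite /commute (pairJ w c w' c') !(expg_pair u u') !(expg_pair w w') !pairM.
by rewrite u1 u1' wE wE' cuw cuw'.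
Qed.

Section Generators.
Variables (gT : finGroupType) (r l : gT).
Hypotheses (r10 : r ^+ 10 = 1) (l2 : l ^+ 2 = 1).
Let u := r ^+ 5 * l.

Lemma gen_inverted : u ^ (r ^+ 5) = u^-1.
Proof.
have ss : r ^+ 5 * r ^+ 5 = 1 by rewrite -expgD.
rewrite /u; move: (r ^+ 5) ss => s ss.
have ll : l * l = 1 := l2.
rewrite conjgE; apply: (mulgI (s * l)); rewrite mulgV.
apply: (mulgI s); rewrite mulg1 -!mulgA (mulgA s s) ss mul1g (mulgA s^-1) mulVg.
by rewrite mul1g (mulgA l l) ll mul1g.
Qed.

Lemma inverted_conj x : x ^ (r ^+ 5) = x^-1 -> x ^ r = (x ^ (r ^+ 6))^-1.
Proof.
move=> xV; rewrite -conjVg -xV -conjgM -expgD.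
by rewrite addnC (expgD r 10 1) r10 mul1g.
Qed.

Lemma inverted_conj6 x : x ^ (r ^+ 5) = x^-1 ->
  (x ^ (r ^+ 6)) ^ (r ^+ 5) = (x ^ (r ^+ 6))^-1.
Proof. by move=> xV; rewrite -conjVg -xV -!conjgM -!expgD. Qed.

(** As l = r^5 u, the group is the product of A and the cyclic group of r. *)
Lemma card_gen_le (A : {group gT}) : u \in A -> r \in 'N(A) ->
  #|<<[set r; l]>>| <= #|A| * 10.
Proof.
move=> Au Nr; have sN : <[r]> \subset 'N(A) by rewrite cycle_subG.
apply: (@leq_trans #|A * <[r]>|).
  rewrite -norm_joinEr // subset_leq_card // gen_subG subUset !sub1set.
  have Rr : r \in A <*> <[r]> by rewrite mem_gen // inE cycle_id orbT.
  rewrite Rr /= -(mul1g l) -r10 (expgD r 5 5) -mulgA groupM ?groupX //.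
  by rewrite mem_gen // inE Au.
apply: (@leq_trans (#|A| * #|<[r]>|)).
  by rewrite mul_cardG leq_pmulr // cardG_gt0.
by rewrite leq_mul2l dvdn_leq ?orbT // -orderE order_dvdn r10.
Qed.

Lemma normal_cycle_gen (k : nat) : u ^ (r ^+ 6) = u ^+ k -> r \in 'N(<[u]>).
Proof.
move=> uc; rewrite -cycle_subG norms_cycle inverted_conj ?gen_inverted //.
by rewrite uc groupV mem_cycle.
Qed.

Lemma normal_cycle2_gen (m k : nat) :
  let w := u ^ (r ^+ 6) in w ^ (r ^+ 6) = w ^+ m * u ^+ k ->
  r \in 'N(<[u]> <*> <[w]>).
Proof.
move=> w wE; rewrite inE conjYg -!cycleJ join_subG !cycle_subG.
have Ju x : x \in <[u]> -> x \in <[u]> <*> <[w]>.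
  by move=> ux; rewrite mem_gen // inE ux.
have Jw x : x \in <[w]> -> x \in <[u]> <*> <[w]>.
  by move=> ux; rewrite mem_gen // inE ux orbT.
rewrite (inverted_conj gen_inverted) groupV (Jw w) ?cycle_id //.
rewrite (inverted_conj (inverted_conj6 gen_inverted)) groupV -/w wE.
by rewrite groupM ?(Jw (w ^+ m)) ?(Ju (u ^+ k)) ?mem_cycle.
Qed.

Lemma card_join_commute (x y : gT) : commute x y ->
  #|<[x]> <*> <[y]>| <= #[x] * #[y].
Proof.
move=> cxy; rewrite cent_joinEr; last by rewrite cycle_subG /= cent_cycle; apply/cent1P.
by rewrite !orderE mul_cardG leq_pmulr // cardG_gt0.
Qed.

(** The datum makes the conjugates of u stay in a subgroup of order at most
    p^2. *)
Lemma realizes_card_le d : (0 < p)%N -> realizes d r l ->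
  #|<<[set r; l]>>| <= 10 * p ^ 2.
Proof.
move=> p0; rewrite /realizes -/u mulnC; case: d => [k [u1 uc]|t n [u1 cuw wE]].
  apply: leq_trans (card_gen_le (cycle_id _) (normal_cycle_gen uc)) _.
  by rewrite leq_mul2r dvdn_leq ?expn_gt0 ?p0 // -orderE order_dvdn u1.
have Au : u \in <[u]> <*> <[u ^ (r ^+ 6)]> by rewrite mem_gen // inE cycle_id.
apply: leq_trans (card_gen_le Au (normal_cycle2_gen wE)) _.
rewrite leq_mul2r; apply: leq_trans (card_join_commute cuw) _.
rewrite orderJ (expnD _ 1 1) leq_mul // dvdn_leq // order_dvdn u1 //.
Qed.

End Generators.
End Realization.

Section Linear.
Local Open Scope group_scope.
Variables (p : nat) (p_pr : prime p) (gT : finGroupType) (u w : gT).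
Hypotheses (up : u ^+ p = 1) (wp : w ^+ p = 1) (cuw : commute u w).
Implicit Types a b k : 'F_p.
Let Dp := Fp_cast p_pr.

(** The elements of the elementary abelian group generated by u and w, with
    coordinates in the prime field. *)
Definition lin a b := u ^+ a * w ^+ b.

Lemma lin10 : lin 1%R 0%R = u.
Proof. by rewrite /lin expg0 mulg1 (expgZ_nat Dp 1). Qed.

Lemma lin01 : lin 0%R 1%R = w.
Proof. by rewrite /lin expg0 mul1g (expgZ_nat Dp 1). Qed.

Lemma lin00 : lin 0%R 0%R = 1.
Proof. by rewrite /lin !expg0 mulg1. Qed.

Lemma linD a b a' b' : lin a b * lin a' b' = lin (a + a')%R (b + b')%R.
Proof.
rewrite /lin (expgZD Dp) // (expgZD Dp) // !mulgA; congr (_ * _).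
rewrite -!mulgA; congr (_ * _); apply/esym; apply: commuteX2; exact: cuw.
Qed.

Lemma lin_comm a b a' b' : commute (lin a b) (lin a' b').
Proof. by rewrite /commute !linD GRing.addrC [(b + _)%R]GRing.addrC. Qed.

Lemma linN a b : (lin a b)^-1 = lin (- a)%R (- b)%R.
Proof.
by apply: (mulgI (lin a b)); rewrite mulgV linD !GRing.subrr lin00.
Qed.

Lemma linX a b k : lin a b ^+ k = lin (a * k)%R (b * k)%R.
Proof.
rewrite /lin expgMn; last by apply: commuteX2; exact: cuw.
by rewrite !(expgZM Dp).
Qed.

Lemma linp a b : lin a b ^+ p = 1.
Proof.
rewrite /lin expgMn; last by apply: commuteX2; exact: cuw.
by rewrite -!expgM ![(_ * p)%N]mulnC !expgM up wp !expg1n mulg1.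
Qed.

Lemma linJ (g : gT) a1 b1 a2 b2 :
    u ^ g = lin a1 b1 -> w ^ g = lin a2 b2 -> forall a b,
  lin a b ^ g = lin (a1 * a + a2 * b)%R (b1 * a + b2 * b)%R.
Proof. by move=> ug wg a b; rewrite {1}/lin conjMg !conjXg ug wg !linX linD. Qed.

End Linear.

Section Norm.
Local Open Scope group_scope.

(** The fifth power of c x is the norm of x for the conjugation by c. *)
Lemma norm_conj (gT : finGroupType) (c x : gT) : c ^+ 5 = 1 ->
  (c * x) ^+ 5
  = (((x ^ c) ^ c) ^ c) ^ c * ((x ^ c) ^ c) ^ c * (x ^ c) ^ c * x ^ c * x.
Proof.
move=> c5; have c5' : c * (c * (c * (c * c))) = 1 by exact: c5.
rewrite !expgS expg0 mulg1 !conjgE.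
apply: (mulgI (c * (c * (c * (c * c))))); rewrite {1}c5' mul1g.
by rewrite !mulgA !mulgK.
Qed.

End Norm.

(** * Existence and uniqueness of the datum *)

Section Classification.
Local Open Scope group_scope.
Variables (p : nat) (p_pr : prime p) (p_ge11 : (11 <= p)%N).
Variables (gT : finGroupType) (r l : gT).
Hypotheses (r10 : r ^+ 10 = 1) (l2 : l ^+ 2 = 1).
Hypothesis oG : #|<<[set r; l]>>| = (10 * p ^ 2)%N.
Let u := r ^+ 5 * l.
Let w := u ^ (r ^+ 6).
Let Dp := Fp_cast p_pr.
Let p0 : (0 < p)%N := prime_gt0 p_pr.

Lemma p2_cast : (Zp_trunc (p ^ 2)).+2 = (p ^ 2)%N.
Proof. by apply: Zp_cast; apply: (@leq_trans (11 ^ 2)); rewrite // leq_exp2r. Qed.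

(** Otherwise the cyclic group of u, normal here, would be too small for the
    order of the whole group. *)
Lemma order_gen_ge (k : nat) : w = u ^+ k -> p ^ 2 <= #[u].
Proof.
move=> uc; have := card_gen_le r10 (cycle_id u) (normal_cycle_gen r10 l2 uc).
by rewrite oG mulnC leq_mul2r.
Qed.

Lemma cyc_order (k : 'Z_(p ^ 2)) : realizes (Cyc k) r l -> #[u] = (p ^ 2)%N.
Proof.
case=> u1 uc; apply/eqP; rewrite eqn_leq (order_gen_ge uc) andbT.
by rewrite dvdn_leq ?expn_gt0 ?p0 // order_dvdn u1.
Qed.

Lemma gen_conj_notin_cycle : u ^+ p = 1 -> w \notin <[u]>.
Proof.
move=> up; apply/negP => /cycleP[k uc].
have : #[u] <= p by rewrite dvdn_leq // order_dvdn up.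
by move/(leq_trans (order_gen_ge uc)); rewrite leqNgt -{1}(expn1 p) ltn_exp2l // prime_gt1.
Qed.

Lemma gen_conj_expgp : u ^+ p = 1 -> w ^+ p = 1.
Proof. by move=> up; rewrite -conjXg up conj1g. Qed.

Lemma lin_inj0 (a b : 'F_p) : u ^+ p = 1 -> commute u w ->
  lin u w a b = 1 -> a = 0%R /\ b = 0%R.
Proof.
move=> up cuw ab1; have wp := gen_conj_expgp up; have wu := gen_conj_notin_cycle up.
have b0 : b = 0%R.
  apply/eqP; apply: contraNT wu => b0; rewrite -[w]expg1 -(expgZ_nat Dp 1 wp).
  rewrite -[(1%:R)%R](GRing.mulfV b0) (expgZM Dp) //.
  have -> : w ^+ b = (u ^+ a)^-1.
    by apply: (mulgI (u ^+ a)); rewrite mulgV.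
  by rewrite groupX // groupV mem_cycle.
split=> //; apply/eqP; apply: contraNT wu => a0.
have u1 : u = 1.
  rewrite -[u]expg1 -(expgZ_nat Dp 1 up) -[(1%:R)%R](GRing.mulfV a0) (expgZM Dp) //.
  have -> : u ^+ a = 1 by move: ab1; rewrite b0 /lin expg0 mulg1.
  by rewrite expg1n.
by rewrite /w u1 conj1g group1.
Qed.

Lemma lin_inj (a b a' b' : 'F_p) : u ^+ p = 1 -> commute u w ->
  lin u w a b = lin u w a' b' -> a = a' /\ b = b'.
Proof.
move=> up cuw e.
have [] := @lin_inj0 (a - a')%R (b - b')%R up cuw.
  by rewrite -linD ?gen_conj_expgp // -linN ?gen_conj_expgp // e mulgV.
by move=> /eqP; rewrite GRing.subr_eq0 => /eqP -> /eqP; rewrite GRing.subr_eq0 => /eqP.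
Qed.

Lemma realizes_inj (d d' : datum p) : realizes d r l -> realizes d' r l -> d = d'.
Proof.
have noCQ k (t n : 'F_p) : realizes (Cyc k : datum p) r l -> realizes (Quad t n) r l -> False.
  move=> /cyc_order ou [up _ _]; have : #[u] <= p.
    by rewrite dvdn_leq ?prime_gt0 // order_dvdn; apply/eqP; exact: up.
  by rewrite ou leqNgt -{1}(expn1 p) ltn_exp2l // prime_gt1.
case: d d' => [k|t n] [k'|t' n'] R R'; try by [case: (noCQ _ _ _ R R')|case: (noCQ _ _ _ R' R)].
  have ou := cyc_order R; case: R R' => [_ uc] [_]; rewrite {}uc => /eqP.
  rewrite eq_expg_mod_order ou !modn_small; last 2 first.
  - by rewrite -[X in _ < X]p2_cast.
  - by rewrite -[X in _ < X]p2_cast.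
  by move=> /eqP/val_inj ->.
case: R R' => [up cuw wE] [_ _]; rewrite wE.
rewrite -/u -/w.
have E (a b : 'F_p) : w ^+ a * u ^+ b = lin u w b a.
  by rewrite /lin; apply: commuteX2.
rewrite !E => /lin_inj[] // /GRing.oppr_inj -> ->.
by [].
Qed.

(** The vanishing of 1 + X + X^2 + X^3 + X^4 modulo X - k, respectively modulo
    X^2 - t X + n, where the two equations are those of the coefficients in the
    basis 1, X. *)
Definition admissible (d : datum p) : Prop :=
  match d with
  | Cyc k => 1 + k + k ^+ 2 + k ^+ 3 + k ^+ 4 = 0
  | Quad t n => n * (1 + t + t ^+ 2 - n) = 1
      /\ 1 + t + t ^+ 2 + t ^+ 3 = n + 2%:R * t * n
  end%R.

Lemma coprime_p10 : coprime p 10.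
Proof.
rewrite prime_coprime //; apply/negP => /dvdn_leq.
by move=> /(_ isT); rewrite leqNgt p_ge11.
Qed.

Section Sylow.
Hypotheses (ro : #[r] = 10%N) (rl5 : (r * l) ^+ 5 = 1).
Let G := <<[set r; l]>>%G.

(** The number of Sylow p-subgroups divides 10 and is 1 modulo p > 10. *)
Lemma normal_Sylow : exists P : {group gT},
  [/\ P <| G, #|P| = (p ^ 2)%N & abelian P].
Proof.
have /normal_sylowP[P sylP nPG] : #|'Syl_p(G)| == 1%N.
  have [P sylP] := Sylow_exists p G.
  have md := card_Syl_mod G p_pr; have : #|'Syl_p(G)| %| 10 * p ^ 2.
    by rewrite -oG card_Syl_dvd.
  rewrite Gauss_dvdl => [/(dvdn_leq (isT : 0 < 10)) le10|].
    by rewrite -md modn_small //; apply: leq_ltn_trans le10 _.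
  rewrite coprimeXr // coprime_sym prime_coprime //; apply/negP => /eqP pd.
  by move: md; rewrite pd.
have oP : #|P| = (p ^ 2)%N.
  rewrite (card_Hall sylP) oG p_part lognM ?expn_gt0 ?p0 //.
  by rewrite logn_coprime ?coprime_p10 // pfactorK.
by exists P; rewrite (card_p2group_abelian p_pr).
Qed.

(** The quotient by P is cyclic, generated by the image of r, so that the
    relation (r l)^5 = 1 becomes r^5 l = 1 there. *)
Lemma gen_in_Sylow (P : {group gT}) : P <| G -> #|P| = (p ^ 2)%N ->
  u \in P.
Proof.
move=> nPG oP; have [sPG nP] := andP nPG.
have Gr : r \in G by rewrite mem_gen ?set21.
have Gl : l \in G by rewrite mem_gen ?set22.
have Nr := subsetP nP _ Gr; have Nl := subsetP nP _ Gl.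
have TI : P :&: <[r]> = 1.
  apply: coprime_TIg; rewrite oP -orderE ro coprimeXl //; exact: coprime_p10.
have defG : P * <[r]> = G.
  apply/eqP; rewrite eqEcard TI_cardMg // oP -orderE ro oG mulnC leqnn andbT.
  by rewrite mul_subG // cycle_subG.
have abQ : abelian (G / P).
  by rewrite -defG quotientMidl quotient_cycle // cycle_abelian.
apply: coset_idr; first by rewrite groupM ?groupX.
have cRL : commute (coset P r) (coset P l).
  by apply: (centsP abQ); apply: mem_quotient.
have : coset P ((r * l) ^+ 5) = 1 by rewrite rl5 morph1.
rewrite morphX ?groupM // morphM // expgMn // => RL5.
have L2 : coset P l ^+ 2 = 1 by rewrite -morphX // l2 morph1.
rewrite /u morphM ?groupX // morphX // -[RHS]RL5; congr (_ * _).
by rewrite (expgD _ 4 1) (expgM _ 2 2) L2 expg1n mul1g.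
Qed.

Lemma norm_gen : let c := r ^+ 6 in
  (((u ^ c) ^ c) ^ c) ^ c * ((u ^ c) ^ c) ^ c * (u ^ c) ^ c * u ^ c * u = 1.
Proof.
move=> c; have c5 : c ^+ 5 = 1.
  by rewrite -expgM (expgM r 10 3) r10 expg1n.
rewrite -norm_conj // -[RHS]rl5; congr (_ ^+ 5).
by rewrite /u mulgA -expgD (expgD r 10 1) r10 mul1g.
Qed.

(** Either conjugation by r^6 preserves the cyclic group of u, which is then the
    whole Sylow subgroup, or u and its conjugate w are a basis of it over the
    prime field. *)
Lemma realizes_exists : exists2 d, admissible d & realizes d r l.
Proof.
have [P [nPG oP abP]] := normal_Sylow; have [sPG nP] := andP nPG.
have Pu := gen_in_Sylow nPG oP.
have Gr : r \in G by rewrite mem_gen ?set21.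
have Nr := subsetP nP _ Gr; set c := r ^+ 6.
have Pw : w \in P by rewrite memJ_norm ?groupX.
have Pwc : w ^ c \in P by rewrite memJ_norm ?groupX.
have nrm : ((w ^ c) ^ c) ^ c * (w ^ c) ^ c * w ^ c * w * u = 1 := norm_gen.
have ou : #[u] %| p ^ 2 by rewrite -oP order_dvdG.
have [wu|wu] := boolP (w \in <[u]>).
  have [k uc] := cycleP _ _ wu.
  have oup : #[u] = (p ^ 2)%N.
    by apply/eqP; rewrite eqn_leq (order_gen_ge uc) andbT dvdn_leq ?expn_gt0 ?p0.
  have up : u ^+ (p ^ 2) = 1 by rewrite -oup expg_order.
  have uk : w = u ^+ (k%:R : 'Z_(p ^ 2))%R by rewrite (expgZ_nat p2_cast).
  exists (Cyc (k%:R)%R); last by split.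
  move: uk; set kk := (k%:R)%R => uk.
  have Jk (a : 'Z_(p ^ 2)) : (u ^+ a) ^ c = u ^+ (kk * a)%R.
    by rewrite conjXg -/w uk (expgZM p2_cast).
  pose S := (kk * (kk * (kk * kk)) + kk * (kk * kk) + kk * kk + kk + 1%:R)%R.
  have : u ^+ S = 1.
    by rewrite -[RHS]nrm uk !Jk !(expgZD p2_cast).
  move/eqP; rewrite -order_dvdn oup => S0.
  have {}S0 : S = 0%R.
    apply: val_inj; change (nat_of_ord S = 0%N).
    have ltS : (S < p ^ 2)%N by rewrite -[X in (_ < X)%N]p2_cast.
    by rewrite -(modn_small ltS); apply/eqP.
  by rewrite /= -[RHS]S0 /S; ring.
have uP : #[u] = p.
  have /(dvdn_pfactor _ _ p_pr)[[|[|[|m]]] // le2 ou'] := ou.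
  (* u = 1 would put w in the trivial group *)
  - by case/negP: wu; rewrite /w ((eqP : _ -> u = 1) _) ?conj1g ?group1 // -order_eq1 ou'.
  case/negP: wu; have -> // : <[u]> = P.
  by apply/eqP; rewrite eqEcard cycle_subG Pu oP -ou' orderE leqnn.
have up : u ^+ p = 1 by rewrite -uP expg_order.
have wp : w ^+ p = 1 by rewrite -conjXg up conj1g.
have cuw : commute u w by apply: (centsP abP).
have ow : #[w] = p by rewrite orderJ.
have TI : <[u]> :&: <[w]> = 1.
  rewrite setIC; apply: prime_TIg; first by rewrite -orderE ow.
  by rewrite cycle_subG.
have defP : <[u]> * <[w]> = P.
  apply/eqP; rewrite eqEcard TI_cardMg // -!orderE uP ow oP leqnn andbT.
  by rewrite mul_subG // cycle_subG.
have [a [b wc]] : exists a b : 'F_p, w ^ c = lin u w a b.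
  have /mulsgP[_ _ /cycleP[i ->] /cycleP[j ->] ->] : w ^ c \in <[u]> * <[w]>.
    by rewrite defP.
  by exists (i%:R)%R, (j%:R)%R; rewrite /lin !(expgZ_nat Dp).
have w01 : w = lin u w (0%R : 'F_p) 1%R by rewrite (lin01 p_pr u wp).
have u10 : u = lin u w (1%R : 'F_p) 0%R by rewrite (lin10 p_pr w up).
have uc : u ^ c = lin u w (0%R : 'F_p) 1%R by rewrite -w01.
have Jl := linJ p_pr up wp cuw uc wc.
have lJ1 : (w ^ c) ^ c = lin u w (a * b)%R (a + b * b)%R.
  by rewrite wc Jl; congr lin; ring.
have lJ2 : ((w ^ c) ^ c) ^ c = lin u w (a * (a + b * b))%R (a * b + b * (a + b * b))%R.
  by rewrite lJ1 Jl; congr lin; ring.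
have : lin u w (a * (a + b * b) + a * b + a + 1)%R
    (a * b + b * (a + b * b) + (a + b * b) + b + 1)%R = 1.
  rewrite -[RHS]nrm lJ2 lJ1 wc [X in _ = _ * X * _]w01 [X in _ = _ * X]u10.
  by rewrite !linD //; congr lin; ring.
case/lin_inj0 => // e1 e2.
exists (Quad b (- a)%R); last first.
  split=> //; rewrite -/u -/w -/c wc /lin GRing.opprK; exact: commuteX2.
split.
  by apply/eqP; rewrite eq_sym -GRing.subr_eq0 -[X in _ == X]e1; apply/eqP; ring.
by apply/eqP; rewrite -GRing.subr_eq0 -[X in _ == X]e2; apply/eqP; ring.
Qed.

End Sylow.
End Classification.

(** * Affine models *)

(** The permutations x |-> - al x and x |-> v - x of an abelian group A, for an
    endomorphism al with 1 + al + al^2 + al^3 + al^4 = 0: they play the parts of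
    r and l, and then u is the translation by v. *)
Section Affine.
Variables (A : finZmodType) (al : A -> A) (v : A).
Hypothesis alD : {morph al : x y / (x + y)%R}.
Hypothesis norm0 :
  forall x, (al (al (al (al x))) + al (al (al x)) + al (al x) + al x + x = 0)%R.
Local Open Scope group_scope.

Let al0 : al 0%R = 0%R.
Proof. by apply: (addrI (al 0%R)); rewrite -alD !addr0. Qed.

Let alN x : al (- x)%R = (- al x)%R.
Proof. by apply: (addrI (al x)); rewrite -alD !subrr al0. Qed.

Lemma al5 x : al (al (al (al (al x)))) = x.
Proof.
apply: (addIr (al (al (al (al x))) + al (al (al x)) + al (al x) + al x)%R).
by rewrite !addrA (norm0 (al x)) -!addrA [RHS]addrC !addrA (norm0 x).
Qed.

Lemma al_inj : injective al.
Proof. by move=> x y e; rewrite -(al5 x) -(al5 y) e. Qed.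

Lemma opp_al_inj : injective (fun x => (- al x)%R).
Proof. by move=> x y /oppr_inj/al_inj. Qed.

Lemma reflect_inj : injective (fun x : A => (v - x)%R).
Proof. by move=> x y /addrI/oppr_inj. Qed.

Definition translation (a : A) : {perm A} := perm (addIr a).
Definition affine_r : {perm A} := perm opp_al_inj.
Definition affine_l : {perm A} := perm reflect_inj.

Lemma translationE a x : translation a x = (x + a)%R.
Proof. by rewrite permE. Qed.

Lemma affine_rE x : affine_r x = (- al x)%R.
Proof. by rewrite permE. Qed.

Lemma affine_lE x : affine_l x = (v - x)%R.
Proof. by rewrite permE. Qed.

Lemma translationD a b : translation (a + b)%R = translation a * translation b.
Proof. by apply/permP => x; rewrite permM !translationE addrA. Qed.

Lemma translation0 : translation 0%R = 1.
Proof. by apply/permP => x; rewrite perm1 translationE addr0. Qed.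

Lemma translationMn a m : translation (a *+ m)%R = translation a ^+ m.
Proof.
by elim: m => [|m IH]; rewrite ?mulr0n ?translation0 // mulrS expgS translationD IH.
Qed.

Lemma affine_r5E x : (affine_r ^+ 5) x = (- x)%R.
Proof.
rewrite !expgS expg0 mulg1 !permM !affine_rE !alN !opprK.
by rewrite al5.
Qed.

Lemma affine_r6E x : (affine_r ^+ 6) x = al x.
Proof. by rewrite expgSr permM affine_r5E affine_rE alN opprK. Qed.

Lemma affine_r10 : affine_r ^+ 10 = 1.
Proof.
by apply/permP => x; rewrite (expgD _ 5 5) permM !affine_r5E opprK perm1.
Qed.

Lemma affine_l2 : affine_l ^+ 2 = 1.
Proof.
by apply/permP => x; rewrite expgS expg1 permM !affine_lE perm1 subKr.
Qed.

Lemma affine_rlE x : (affine_r * affine_l) x = (al x + v)%R.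
Proof. by rewrite permM affine_rE affine_lE opprK addrC. Qed.

Lemma affine_rl5 : (affine_r * affine_l) ^+ 5 = 1.
Proof.
apply/permP => x; rewrite perm1 !expgS expg0 mulg1 !(permM (affine_r * affine_l)).
by rewrite !affine_rlE !alD al5 -[RHS]addr0 -[X in _ = (_ + X)%R](norm0 v) !addrA.
Qed.

Lemma affine_r5l : affine_r ^+ 5 * affine_l = translation v.
Proof.
by apply/permP => x; rewrite permM affine_r5E affine_lE opprK translationE addrC.
Qed.

Lemma translationJ a : translation a ^ (affine_r ^+ 6) = translation (al a).
Proof.
apply/permP => x; have [y ->] : exists y, x = (affine_r ^+ 6) y.
  by exists ((affine_r ^+ 6)^-1 x); rewrite permKV.
by rewrite permJ translationE !affine_r6E alD translationE.
Qed.

(** If the square of r fixed v, then al would exchange v and al v, and the norm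
    of v minus that of al v would give al v = v, hence 5 v = 0. *)
Lemma order_affine_r : (v *+ 2 != 0)%R -> (v *+ 5 != 0)%R -> #[affine_r] = 10%N.
Proof.
move=> v2 v5; have : #[affine_r] %| 10 by rewrite order_dvdn affine_r10.
have : ~~ (#[affine_r] %| 5).
  rewrite order_dvdn; apply: contraNneq v2 => /permP/(_ v).
  by rewrite affine_r5E perm1 mulr2n => {1}<-; rewrite addNr.
have : ~~ (#[affine_r] %| 2).
  rewrite order_dvdn; apply: contraNneq v5 => /permP/(_ v).
  rewrite expgS expg1 permM !affine_rE alN opprK perm1 => a2.
  have e1 := norm0 v; have e2 := norm0 (al v); rewrite !a2 in e1 e2.
  have avv : al v = v.
    apply: (addrI (al v + v + al v + v)%R).
    by rewrite e2 [RHS]addrC !addrA e1.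
  by rewrite !avv in e1; rewrite !mulrS mulr0n addr0 !addrA e1.
rewrite (_ : 10 = 2 * 5)%N // => n2 n5 d10.
apply/eqP; rewrite eqn_dvd d10 /=.
have d2 : 2 %| #[affine_r].
  rewrite -[_ %| _]negbK -prime_coprime // coprime_sym; apply: contra n5 => cop.
  by move: d10; rewrite Gauss_dvdr.
have d5 : 5 %| #[affine_r].
  rewrite -[_ %| _]negbK -prime_coprime // coprime_sym; apply: contra n2 => cop.
  by move: d10; rewrite mulnC Gauss_dvdr.
by rewrite Gauss_dvd // d2 d5.
Qed.

Section Span.
Variable p : nat.
Hypotheses (p_pr : prime p) (p_ge11 : (11 <= p)%N) (cA : #|A| = (p ^ 2)%N).
Hypotheses (v2 : (v *+ 2 != 0)%R) (v5 : (v *+ 5 != 0)%R).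
Hypothesis span : forall a, exists i j, a = (v *+ i + al v *+ j)%R.

(** Transitivity on A and the order 10 of r bound the order of the group below,
    and the datum bounds it above. *)
Lemma affine_map (d : datum p) : realizes d affine_r affine_l ->
  exists2 M, regular_map10 p M & realizes d (rotation M) (reversal M).
Proof.
move=> Rd; have ro := order_affine_r v2 v5.
have l1 : affine_l != 1.
  apply: contraNneq v2 => l1; have := affine_rl5; rewrite l1 mulg1 => r5.
  have : #[affine_r] %| 5 by rewrite order_dvdn r5.
  by rewrite ro.
pose G := <<[set affine_r; affine_l]>>%G.
have Gr : affine_r \in G by rewrite mem_gen ?set21.
have Gl : affine_l \in G by rewrite mem_gen ?set22.
have Gv : translation v \in G by rewrite -affine_r5l groupM ?groupX.
have Gav : translation (al v) \in G by rewrite -translationJ groupJ ?groupX.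
have tr : [transitive G, on [set: A] | 'P].
  apply/imsetP; exists 0%R => //; apply/setP => y; rewrite inE.
  have [i [j ->]] := span y; apply/esym/orbitP.
  exists (translation (v *+ i + al v *+ j)%R); last by rewrite /= apermE translationE add0r.
  by rewrite translationD !translationMn groupM ?groupX.
have oG : #|G| = (10 * p ^ 2)%N.
  apply/eqP; rewrite eqn_leq (realizes_card_le affine_r10 affine_l2 _ Rd) ?prime_gt0 //=.
  rewrite dvdn_leq // Gauss_dvd; last first.
    by rewrite coprimeXr // coprime_sym coprime_p10.
  by rewrite -{1}ro order_dvdG //= -cA -cardsT (atrans_dvd tr).
have [M [rM cM [f [injf fr fl]]]] := regular_map_exists affine_r affine_l2 l1.
exists M.
  split=> //; first by rewrite cM oG.
    by rewrite -fr order_injm.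
  by rewrite -fr -fl -morphM // -morphX ?groupM // affine_rl5 morph1.
by rewrite -fr -fl; apply: (morph_realizes _ Gr Gl).
Qed.

End Span.
End Affine.

Section Models.
Variables (p : nat) (p_pr : prime p) (p_ge11 : (11 <= p)%N).
Local Open Scope ring_scope.

Let Dp := Fp_cast p_pr.
Let Dp2 := p2_cast p_ge11.

Lemma natF_neq0 (m : nat) : (0 < m < 11)%N -> (m%:R : 'F_p) != 0.
Proof.
move=> /andP[m0 m11]; apply/eqP => /(congr1 val) /=; rewrite val_Fp_nat //.
by rewrite modn_small ?(leq_trans m11) // => m00; rewrite m00 in m0.
Qed.

Lemma natZ_neq0 (m : nat) : (0 < m < 11)%N -> (m%:R : 'Z_(p ^ 2)) != 0.
Proof.
move=> /andP[m0 m11]; apply/eqP => /(congr1 val) /=.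
have p21 : (11 < p ^ 2)%N by apply: (@leq_trans (11 ^ 2)); rewrite // leq_exp2r.
rewrite val_Zp_nat; last by apply: leq_trans p21.
by rewrite modn_small ?(ltn_trans m11) // => m00; rewrite m00 in m0.
Qed.

Lemma cyc_model (k : 'Z_(p ^ 2)) : admissible (Cyc k : datum p) ->
  exists2 M, regular_map10 p M & realizes (Cyc k : datum p) (rotation M) (reversal M).
Proof.
rewrite {1}/admissible => k0; pose al (x : 'Z_(p ^ 2)) := k * x.
have alD : {morph al : x y / x + y} by move=> x y; apply: mulrDr.
have norm0 x : (al (al (al (al x))) + al (al (al x)) + al (al x) + al x + x = 0)%R.
  by rewrite /al /= -[RHS](mulr0 x) -k0; ring.
apply: (@affine_map _ al 1 alD norm0 p) => //.
- by rewrite card_ord Dp2.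
- exact: (natZ_neq0 (m := 2)).
- exact: (natZ_neq0 (m := 5)).
- by move=> a; exists a, 0%N; rewrite mulr0n addr0 natr_Zp.
rewrite /realizes; cbv zeta; rewrite (affine_r5l 1 alD) (translationJ alD) -!translationMn; split.
  have -> : (1 *+ (p ^ 2) = 0 :> 'Z_(p ^ 2)).
    by apply: val_inj; rewrite /= val_Zp_nat ?modnn // -Dp2.
  by rewrite translation0.
by rewrite natr_Zp /al /= mulr1.
Qed.

End Models.

(** A name for the product, to declare its finite additive group structure. *)
Definition plane (p : nat) : Type := ('F_p * 'F_p)%type.
HB.instance Definition _ p := GRing.Zmodule.on (plane p).
HB.instance Definition _ p := Finite.on (plane p).

(** Multiplication by X on the quotient of the polynomials by X^2 - t X + n,
    in the basis 1, X. *)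
Definition companion (p : nat) (t n : 'F_p) (x : plane p) : plane p :=
  (- n * x.2, x.1 + t * x.2)%R.

Lemma companionD p t n : {morph @companion p t n : x y / (x + y)%R}.
Proof. by move=> x y; congr pair; rewrite /=; ring. Qed.

Section QuadModel.
Variables (p : nat) (p_pr : prime p) (p_ge11 : (11 <= p)%N).
Local Open Scope ring_scope.
Let Dp := Fp_cast p_pr.

Lemma planeMn (x y : 'F_p) m : ((x, y) : plane p) *+ m = (x *+ m, y *+ m).
Proof. by elim: m => [|m IH] //; rewrite mulrSr IH !mulrSr. Qed.

Lemma quad_model (t n : 'F_p) : admissible (Quad t n) ->
  exists2 M, regular_map10 p M & realizes (Quad t n) (rotation M) (reversal M).
Proof.
case=> e1 e2; pose al := @companion p t n.
have alD : {morph al : x y / x + y} by exact: companionD.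
have e1' : n * (1 + t + t ^+ 2 - n) - 1 = 0 by rewrite e1 subrr.
have e2' : 1 + t + t ^+ 2 + t ^+ 3 - (n + 2%:R * t * n) = 0 by rewrite e2 subrr.
have norm0 (x : plane p) : (al (al (al (al x))) + al (al (al x)) + al (al x) + al x + x = 0)%R.
  case: x => x y; congr pair; rewrite /=.
    transitivity (- (n * (1 + t + t ^+ 2 - n) - 1) * x
       - n * (1 + t + t ^+ 2 + t ^+ 3 - (n + 2%:R * t * n)) * y); first by ring.
    by rewrite e1' e2'; ring.
  transitivity ((1 + t + t ^+ 2 + t ^+ 3 - (n + 2%:R * t * n)) * x
     + (t * (1 + t + t ^+ 2 + t ^+ 3 - (n + 2%:R * t * n))
     - (n * (1 + t + t ^+ 2 - n) - 1)) * y); first by ring.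
  by rewrite e1' e2'; ring.
have alv : al (1, 0) = (0, 1) by congr pair => /=; ring.
apply: (@affine_map _ al (1, 0) alD norm0 p) => //.
- by rewrite card_prod !card_ord Dp mulnn.
- by rewrite planeMn xpair_eqE negb_and (natF_neq0 p_pr p_ge11 (m := 2)).
- by rewrite planeMn xpair_eqE negb_and (natF_neq0 p_pr p_ge11 (m := 5)).
- move=> [a b]; exists a, b; rewrite alv !planeMn !mul0rn.
  by congr pair; rewrite /= natr_Zp ?addr0 ?add0r.
rewrite /realizes; cbv zeta; rewrite (@affine_r5l (plane p) al (1, 0) alD norm0) !(@translationJ (plane p) al alD norm0) -!translationMn alv; split.
- rewrite planeMn mul0rn; have -> : (1 *+ p = 0 :> 'F_p) by apply: pchar_Fp_0.
  exact: translation0.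
- by rewrite /commute -!translationD addrC.
rewrite -translationD !planeMn !mul0rn !natr_Zp; congr translation.
by congr pair => /=; ring.
Qed.

End QuadModel.

(** * Fifth roots of unity modulo p and p^2 *)

Section Phi5.
Local Open Scope ring_scope.

Definition phi5 (R : comNzRingType) (x : R) := 1 + x + x ^+ 2 + x ^+ 3 + x ^+ 4.

Lemma phi5_expr5 (R : comNzRingType) (x : R) : phi5 x = 0 -> x ^+ 5 = 1.
Proof.
move=> x0; apply/eqP; rewrite -subr_eq0 -(mulr0 (x - 1)) -x0; apply/eqP.
by rewrite /phi5; ring.
Qed.

Lemma phi5_mod (R : comNzRingType) (x : R) i :
  phi5 x = 0 -> x ^+ i = x ^+ (i %% 5).
Proof.
move=> /phi5_expr5 x5.
by rewrite {1}(divn_eq i 5) exprD mulnC exprM x5 expr1n mul1r.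
Qed.

(** The powers of x that occur are permuted. *)
Lemma phi5X (R : comNzRingType) (x : R) i : phi5 x = 0 -> ~~ (5 %| i)%N -> phi5 (x ^+ i) = 0.
Proof.
move=> x0 i5; rewrite -[RHS]x0 /phi5 -!exprM.
rewrite (phi5_mod i) // (phi5_mod (i * 2)) // (phi5_mod (i * 3)) // (phi5_mod (i * 4)) //.
have [i1|[i1|[i1|i1]]] : (i %% 5 = 1 \/ i %% 5 = 2 \/ i %% 5 = 3 \/ i %% 5 = 4)%N by lia.
all: rewrite -(modnMml i 2) -(modnMml i 3) -(modnMml i 4) i1 /=; ring.
Qed.

Lemma phi5_prim (R : comNzRingType) (x : R) : (5%:R : R) != 0 ->
  phi5 x = 0 -> 5.-primitive_root x.
Proof.
move=> n5 x0; have [m pm dm] := prim_order_exists (isT : (0 < 5)%N) (phi5_expr5 x0).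
have [m1|m5] : m = 1%N \/ m = 5%N.
  by apply/pred2P; move: dm; rewrite dvdn_divisors //= !inE.
- case/eqP: n5; rewrite -[RHS]x0 /phi5.
  have -> : x = 1 by have := prim_expr_order pm; rewrite m1 expr1.
  by ring.
by rewrite -m5.
Qed.

Lemma prim_phi5_field (F : fieldType) (x : F) : x ^+ 5 = 1 -> x != 1 -> phi5 x = 0.
Proof.
move=> x5 x1; have : (x - 1) * phi5 x = 0.
  by rewrite -[RHS](subrr 1) -[X in _ = X - _]x5 /phi5; ring.
by move/eqP; rewrite mulf_eq0 subr_eq0 (negPf x1) => /eqP.
Qed.

(** Cauchy's theorem and Lagrange's theorem in the group of units. *)
Lemma unit_order5 (n : nat) : (1 < n)%N ->
  (exists x : 'Z_n, x ^+ 5 = 1 /\ x != 1) <-> (5 %| totient n)%N.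
Proof.
move=> n1; have n0 := ltnW n1; rewrite -(card_units_Zp n0); split.
  case=> x [x5 x1]; have Ux : x \is a GRing.unit.
    by apply/unitrP; exists (x ^+ 4); rewrite -exprS -exprSr x5.
  pose y : {unit 'Z_n} := Sub x Ux.
  have <- : #[y]%g = 5%N.
    apply: nt_prime_order => //.
    by apply: val_inj; rewrite FinRing.val_unitX /= x5.
  by rewrite order_dvdG // inE.
case/(Cauchy (isT : prime 5)) => y _ oy; exists (val y); split.
  by rewrite -FinRing.val_unitX -oy expg_order.
apply/eqP => y1; have : #[y]%g == 1%N by rewrite order_eq1; apply/eqP/val_inj.
by rewrite oy.
Qed.

End Phi5.

Section ModP2.
Variables (p : nat) (p_pr : prime p) (p_ge11 : (11 <= p)%N).
Local Open Scope ring_scope.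
Let Dp := Fp_cast p_pr.
Let Dp2 := p2_cast p_ge11.
Let R := 'Z_(p ^ 2).
Let n1 : (1 < p ^ 2)%N.
Proof. by rewrite -Dp2. Qed.

Lemma nonunitP (x : R) : x \isn't a GRing.unit -> exists y, x = p%:R * y.
Proof.
rewrite -{1}(natr_Zp x) unitZpE // coprime_pexpl // prime_coprime // negbK.
case/dvdnP => m Dm; exists m%:R; rewrite -(natr_Zp x) Dm.
by rewrite natrM mulrC.
Qed.

Lemma p2_0 : p%:R * p%:R = 0 :> R.
Proof.
by rewrite -natrM mulnn; apply: val_inj; rewrite /= val_Zp_nat // modnn.
Qed.

Lemma nonunit_pM (y : R) : p%:R * y \isn't a GRing.unit.
Proof.
apply/negP => U; have : (p%:R * y) * (p%:R * y) \is a GRing.unit by rewrite unitrM U.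
have -> : p%:R * y * (p%:R * y) = p%:R * p%:R * (y * y) by ring.
by rewrite p2_0 mul0r unitr0.
Qed.

Lemma unit_small (m : nat) : (0 < m < 11)%N -> (m%:R : R) \is a GRing.unit.
Proof.
case/andP=> m0 m11; rewrite unitZpE // coprime_pexpl // prime_coprime //.
by apply/negP => /(dvdn_leq m0); rewrite leqNgt (leq_trans m11).
Qed.

Lemma unitr_mul0 (x y : R) : x \is a GRing.unit -> x * y = 0 -> y = 0.
Proof. by move=> Ux /(congr1 ( *%R x^-1)); rewrite mulKr // mulr0. Qed.

(** Were x - 1 not invertible, it would be a multiple of p, of square 0, and
    then 0 = (x - 1) phi5(x) = 5 (x - 1). *)
Lemma phi5_Zp2 (x : R) : x ^+ 5 = 1 -> x != 1 -> phi5 x = 0.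
Proof.
move=> x5 x1; have e0 : (x - 1) * phi5 x = 0.
  by rewrite -[RHS](subrr 1) -[X in _ = X - _]x5 /phi5; ring.
have [U|] := boolP (x - 1 \is a GRing.unit); first exact: unitr_mul0 e0.
move/nonunitP => [y ey]; case/eqP: x1; apply/eqP; rewrite -subr_eq0; apply/eqP.
apply: (@unitr_mul0 5%:R); first exact: unit_small.
rewrite -[RHS]e0 /phi5; have -> : x = 1 + p%:R * y by rewrite -ey; ring.
transitivity (5%:R * p%:R * y + p%:R * p%:R * (y * y * (10%:R + 10%:R * (p%:R * y)
   + 5%:R * (p%:R * y) ^+ 2 + (p%:R * y) ^+ 3))); last by ring.
by rewrite p2_0; ring.
Qed.

(** With y = x^i, again a root, y - 1 divides phi5(y) - phi5(1) = - 5. *)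
Lemma phi5_unit (x : R) i : phi5 x = 0 -> ~~ (5 %| i)%N -> x ^+ i - 1 \is a GRing.unit.
Proof.
move=> x0 i5; have := phi5X x0 i5; set y := x ^+ i => y0.
have : (y - 1) * (y ^+ 3 + 2%:R * y ^+ 2 + 3%:R * y + 4%:R) = - 5%:R.
  by apply/eqP; rewrite -subr_eq0 -[X in _ == X]y0; apply/eqP; rewrite /phi5; ring.
move=> e; have : - (5%:R : R) \is a GRing.unit by rewrite unitrN unit_small.
by rewrite -e unitrM => /andP[].
Qed.

(** Modulo p^2 the fifth roots of unity other than 1 stay distinct modulo p,
    so that at most one of the differences k - x^i fails to be invertible
    while their product vanishes. *)
Lemma phi5_roots_Zp2 (x k : R) : phi5 x = 0 -> phi5 k = 0 ->
  exists2 j, (0 < j < 5)%N & k = x ^+ j.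
Proof.
move=> x0 k0; have x5 := phi5_expr5 x0.
have x4 : x ^+ 4 = - 1 - x - x ^+ 2 - x ^+ 3.
  by apply/eqP; rewrite -subr_eq0 -[X in _ == X]x0; apply/eqP; rewrite /phi5; ring.
(* phi5 factors as the product of the X - x^i *)
have prod0 : (k - x) * (k - x ^+ 2) * (k - x ^+ 3) * (k - x ^+ 4) = 0.
  rewrite -[RHS]k0 /phi5.
  transitivity (k ^+ 4 - (x + x ^+ 2 + x ^+ 3 + x ^+ 4) * k ^+ 3
    + (x ^+ 3 + x ^+ 4 + x ^+ 5 + x ^+ 5 + x ^+ 5 * x + x ^+ 5 * x ^+ 2) * k ^+ 2
    - (x ^+ 5 * x + x ^+ 5 * x ^+ 2 + x ^+ 5 * x ^+ 3 + x ^+ 5 * x ^+ 4) * k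
    + x ^+ 5 * x ^+ 5); first by ring.
  by rewrite x5 x4; ring.
have diff i j : (0 < i < j)%N -> (j < 5)%N -> k - x ^+ i \isn't a GRing.unit ->
    k - x ^+ j \is a GRing.unit.
  move=> /andP[i0 ij] j5 /nonunitP[y ey]; apply: contraT => /nonunitP[z ez].
  have Ux : x ^+ i \is a GRing.unit.
    by rewrite unitrX //; apply/unitrP; exists (x ^+ 4); rewrite -exprS -exprSr x5.
  have Ud : x ^+ (j - i) - 1 \is a GRing.unit by apply: phi5_unit => //; lia.
  have : x ^+ i * (x ^+ (j - i) - 1) \is a GRing.unit by rewrite unitrM Ux Ud.
  have -> : x ^+ i * (x ^+ (j - i) - 1) = (k - x ^+ i) - (k - x ^+ j).
    by rewrite mulrBr -exprD subnKC 1?ltnW // mulr1; ring.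
  by rewrite ey ez -mulrBr (negPf (nonunit_pM _)).
have diff' i j : (0 < i < 5)%N -> (0 < j < 5)%N -> i != j ->
    k - x ^+ i \isn't a GRing.unit -> k - x ^+ j \is a GRing.unit.
  move=> i0 j0; case: ltngtP => // ij _; first by apply: diff; lia.
  by apply: contraNT; apply: diff; lia.
have key j : (0 < j < 5)%N ->
    (forall i, (0 < i < 5)%N -> i != j -> k - x ^+ i \is a GRing.unit) ->
    exists2 j, (0 < j < 5)%N & k = x ^+ j.
  move=> j5 U; exists j => //; apply/eqP; rewrite -subr_eq0; apply/eqP.
  have [j1|[j1|[j1|j1]]] : (j = 1 \/ j = 2 \/ j = 3 \/ j = 4)%N by lia.
  - rewrite j1 in U *; apply: (@unitr_mul0 ((k - x ^+ 2) * (k - x ^+ 3) * (k - x ^+ 4))).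
      by rewrite !unitrM !U.
    by rewrite -[RHS]prod0; ring.
  - rewrite j1 in U *; apply: (@unitr_mul0 ((k - x ^+ 1) * (k - x ^+ 3) * (k - x ^+ 4))).
      by rewrite !unitrM !U.
    by rewrite -[RHS]prod0; ring.
  - rewrite j1 in U *; apply: (@unitr_mul0 ((k - x ^+ 1) * (k - x ^+ 2) * (k - x ^+ 4))).
      by rewrite !unitrM !U.
    by rewrite -[RHS]prod0; ring.
  rewrite j1 in U *; apply: (@unitr_mul0 ((k - x ^+ 1) * (k - x ^+ 2) * (k - x ^+ 3))).
    by rewrite !unitrM !U.
  by rewrite -[RHS]prod0; ring.
have [/existsP[j /andP[j0 Nj]]|/existsPn U] :=
  boolP [exists j : 'I_5, (0 < j)%N && (k - x ^+ j \isn't a GRing.unit)].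
  apply: (key j) => [|i i5 ij]; first by rewrite j0 ltn_ord.
  by apply: diff' Nj; rewrite ?j0 ?ltn_ord // eq_sym.
apply: (key 1%N) => // i /andP[i0 i5] _.
by have := U (Ordinal i5); rewrite i0 /= negbK.
Qed.

End ModP2.

Section ModP.
Variables (p : nat) (p_pr : prime p) (p_ge11 : (11 <= p)%N).
Local Open Scope ring_scope.
Let Dp := Fp_cast p_pr.

Lemma phi5_roots_Fp (x k : 'F_p) : phi5 x = 0 -> phi5 k = 0 ->
  exists2 j, (0 < j < 5)%N & k = x ^+ j.
Proof.
move=> x0 k0; have n5 : (5%:R : 'F_p) != 0.
  by rewrite -(dvdn_pcharf (pchar_Fp p_pr)); apply/negP => /dvdn_leq; lia.
have px := phi5_prim n5 x0; have [j kj] := prim_rootP px (phi5_expr5 k0).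
exists j => //; rewrite ltn_ord andbT lt0n; apply/eqP => j0.
case/eqP: n5; rewrite -[RHS]k0 kj j0 /phi5; ring.
Qed.

Lemma totient_p : totient (pdiv p) = p.-1.
Proof. by rewrite pdiv_id // totient_prime. Qed.

Lemma totient_p2 : totient (p ^ 2) = (p.-1 * p)%N.
Proof. by rewrite totient_pfactor. Qed.

Lemma no_phi5_Fp (x : 'F_p) : (p %% 5 = 4)%N -> phi5 x <> 0.
Proof.
move=> p4 x0; have : (5 %| totient (pdiv p))%N.
  apply/unit_order5; first by rewrite pdiv_id ?prime_gt1.
  exists x; split; first exact: phi5_expr5.
  apply/eqP => x1; move: x0; rewrite x1 => /eqP.
  rewrite (_ : phi5 1 = 5%:R); last by rewrite /phi5; ring.
  by rewrite -(dvdn_pcharf (pchar_Fp p_pr)) => /dvdn_leq; lia.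
by rewrite totient_p; lia.
Qed.

Lemma no_phi5_Zp2 (x : 'Z_(p ^ 2)) : (p %% 5 = 4)%N -> phi5 x <> 0.
Proof.
move=> p4 x0; have : (5 %| totient (p ^ 2))%N.
  apply/unit_order5; first by rewrite -(p2_cast p_ge11).
  exists x; split; first exact: phi5_expr5.
  apply/eqP => x1; have := unit_small p_pr p_ge11 (m := 5) isT.
  rewrite (_ : 5%:R = phi5 (1 : 'Z_(p ^ 2))); last by rewrite /phi5; ring.
  by rewrite -x1 x0 unitr0.
by rewrite totient_p2 Euclid_dvdM // => /orP[]; lia.
Qed.

Lemma exists_phi5_Fp : (p %% 5 = 1)%N -> exists x : 'F_p, phi5 x = 0.
Proof.
move=> p1; have /unit_order5[] : (5 %| totient (pdiv p))%N.
- by rewrite totient_p; lia.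
- by rewrite pdiv_id ?prime_gt1.
by move=> x [x5 x1]; exists x; apply: prim_phi5_field.
Qed.

Lemma exists_phi5_Zp2 : (p %% 5 = 1)%N -> exists x : 'Z_(p ^ 2), phi5 x = 0.
Proof.
move=> p1; have /unit_order5[] : (5 %| totient (p ^ 2))%N.
- by rewrite totient_p2 dvdn_mulr //; lia.
- by rewrite -(p2_cast p_ge11).
by move=> x [x5 x1]; exists x; apply: phi5_Zp2.
Qed.

(** In the field of order p^2, which contains a primitive fifth root of unity z
    because 5 divides p^2 - 1, the element z + z^-1 is a root and is fixed by
    the Frobenius automorphism since z^p = z^-1. *)
Lemma golden_Fp : (p %% 5 = 4)%N -> exists t : 'F_p, t ^+ 2 + t - 1 = 0.
Proof.
move=> p4; have [F pF cF] := pPrimePowerField p_pr (isT : (0 < 2)%N).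
have : (5 %| #|[set: {unit F}]|)%N by rewrite card_finField_unit cF; nia.
case/(Cauchy (isT : prime 5)) => y _ oy; pose z : F := val y.
have z5 : z ^+ 5 = 1 by rewrite -FinRing.val_unitX -oy expg_order.
have z1 : z != 1.
  apply/eqP => y1; have : #[y]%g == 1%N by rewrite order_eq1; apply/eqP/val_inj.
  by rewrite oy.
have z0 := prim_phi5_field z5 z1; pose t := z + z ^+ 4.
have tp : t ^+ p = t.
  rewrite /t -[LHS](pFrobenius_autE pF) rmorphD rmorphXn /= pFrobenius_autE.
  by rewrite (phi5_mod p z0) p4 -exprM (phi5_mod (4 * 4) z0) expr1 addrC.
have [/mapP[m _ tm]|tN] := boolP (t \in [seq (m%:R : F) | m <- iota 0 p]).
  have t0 : t ^+ 2 + t - 1 = 0.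
    transitivity (phi5 z + z ^+ 3 * (z ^+ 5 - 1) + 2%:R * (z ^+ 5 - 1)).
      by rewrite /t /phi5; ring.
    by rewrite z0 z5; ring.
  have pm1 (K : fieldType) : p \in [pchar K] -> (p.-1%:R = -1 :> K).
    move=> pK; apply/eqP; rewrite -subr_eq0 opprK natr1.
    by rewrite prednK ?prime_gt0 // (pcharf0 pK).
  have pE (K : fieldType) : p \in [pchar K] ->
      (p %| m ^ 2 + m + p.-1)%N = (m%:R ^+ 2 + m%:R - 1 == 0 :> K).
    by move=> pK; rewrite (dvdn_pcharf pK) !natrD natrX pm1.
  by exists m%:R; apply/eqP; rewrite -pE ?pchar_Fp // (pE F) // -tm t0.
have szQ : size ('X^p - 'X : {poly F}) = p.+1.
  by rewrite size_polyDl size_polyXn // size_polyN size_polyX ltnS prime_gt1.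
have : (size (t :: [seq (m%:R : F) | m <- iota 0 p]) < size ('X^p - 'X : {poly F})%R)%N.
  apply: max_poly_roots; first by rewrite -size_poly_eq0 szQ.
  - rewrite /= rootE !hornerE tp subrr eqxx /=; apply/allP => _ /mapP[m _ ->].
    by rewrite rootE !hornerE -(pFrobenius_autE pF) pFrobenius_aut_nat subrr.
  rewrite /= tN /= map_inj_in_uniq ?iota_uniq // => m m'.
  rewrite !mem_iota !add0n /=.
  wlog le : m m' / (m <= m')%N.
    by move=> W mp m'p e; case: (leqP m m') => [/W|/ltnW/W]; [apply|move=> <-].
  move=> mp m'p e; have : (p %| m' - m)%N.
    by rewrite (dvdn_pcharf pF) natrB // e subrr.
  by move: mp m'p le; case: (posnP (m' - m)) => [|/dvdn_leq H + + + /H]; lia.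
by rewrite szQ /= size_map size_iota ltnn.
Qed.

(** The quotient of 1 + X + X^2 + X^3 + X^4 by X^2 - t X + n has linear
    coefficient 1 + t and constant coefficient 1/n; eliminating gives
    (1 - n) (t (1 + n) + n) = 0, and in the second case phi5(n) = 0. *)
Lemma admissible_quad (t n : 'F_p) : admissible (Quad t n) ->
  (n = 1 /\ t ^+ 2 + t - 1 = 0) \/ (phi5 n = 0 /\ t * (1 + n) = - n).
Proof.
case=> e1 e2.
have : (1 - n) * (t * (1 + n) + n) = 0.
  transitivity (- (n * (1 + t + t ^+ 2 - n) - 1) * t + n * (1 + t + t ^+ 2 + t ^+ 3 - (n + 2%:R * t * n))).
    by ring.
  by rewrite e1 e2; ring.
move/eqP; rewrite mulf_eq0 => /orP[/eqP n1|/eqP tn].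
  have {n1} n1 : n = 1 by apply/esym/eqP; rewrite -subr_eq0 n1.
  left; split=> //; move: e1; rewrite n1 => e1.
  by rewrite -[RHS](subrr 1) -[X in _ = X - _]e1; ring.
right; split; last by apply/eqP; rewrite -subr_eq0 opprK tn.
(* phi5 n as a combination of the hypothesis on n and of the relation tn *)
transitivity ((1 + n) ^+ 2 * (1 - n * (1 + t + t ^+ 2 - n)) + n * (1 + t * (1 + n)) * (t * (1 + n) + n)).
  by rewrite /phi5; ring.
by rewrite e1 tn; ring.
Qed.

Lemma admissible_golden (t : 'F_p) : t ^+ 2 + t - 1 = 0 -> admissible (Quad t 1).
Proof.
move=> t0; have t2 : t ^+ 2 = 1 - t.
  by apply/eqP; rewrite -subr_eq0 -[X in _ == X]t0; apply/eqP; ring.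
have t3 : t ^+ 3 = t - t ^+ 2 by rewrite exprS {1}t2; ring.
by split; rewrite ?t3 t2; ring.
Qed.

(** The quadratic polynomial with the roots x and x^e. *)
Definition eigen_datum (x : 'F_p) (e : nat) : datum p :=
  Quad (x + x ^+ e) (x ^+ e.+1).

Lemma admissible_eigen (x : 'F_p) e : phi5 x = 0 -> e \in [:: 2; 4]%N ->
  admissible (eigen_datum x e).
Proof.
move=> x0; have x5 := phi5_expr5 x0; rewrite !inE => /orP[]/eqP->.
  split; apply/eqP; rewrite -subr_eq0; apply/eqP.
    transitivity (phi5 x * (x ^+ 3 + x - 1)); first by rewrite /phi5; ring.
    by rewrite x0 mul0r.
  transitivity (phi5 x * (1 + x ^+ 2)); first by rewrite /phi5; ring.
  by rewrite x0 mul0r.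
rewrite /eigen_datum x5; apply: admissible_golden.
transitivity (phi5 x + x ^+ 3 * (x ^+ 5 - 1) + 2%:R * (x ^+ 5 - 1)); first by rewrite /phi5; ring.
by rewrite x0 x5; ring.
Qed.

End ModP.

(** * Groups satisfying the three presentations *)

Section Bounds.
Local Open Scope group_scope.
Variable gT : finGroupType.
Implicit Types (a b c d x : gT) (A B : {group gT}).

Lemma card_joing_cycle_le A x n : (0 < n)%N -> x ^+ n = 1 -> x \in 'N(A) ->
  #|A <*> <[x]>| <= #|A| * n.
Proof.
move=> n0 xn Nx; rewrite norm_joinEr ?cycle_subG //.
apply: (@leq_trans (#|A| * #|<[x]>|)).
  by rewrite mul_cardG leq_pmulr // cardG_gt0.
by rewrite leq_mul2l dvdn_leq ?orbT // -orderE order_dvdn xn.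
Qed.

Lemma conj_inverted d x : d ^+ 2 = 1 -> (d * x) ^+ 2 = 1 -> x ^ d = x^-1.
Proof.
move=> d2 dx2; have dV : d^-1 = d by apply: (mulIg d); rewrite mulVg -d2.
rewrite conjgE dV; apply: (mulIg x); rewrite mulVg -[RHS]dx2.
by rewrite expgS expg1 !mulgA.
Qed.

(** A tower of cyclic extensions of orders p, p, 5 and 2, for both presentations
    on four generators. *)
Lemma bound_split (p : nat) a b c d x y z : (0 < p)%N ->
    a ^+ p = 1 -> b ^+ p = 1 -> c ^+ 5 = 1 -> d ^+ 2 = 1 -> [~ a, b] = 1 ->
    (d * a) ^+ 2 = 1 -> (d * b) ^+ 2 = 1 ->
    x \in <[a]> <*> <[b]> -> y \in <[a]> <*> <[b]> -> z \in <[a]> <*> <[b]> ->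
    c * a * c^-1 = x -> c * b * c^-1 = y -> d * c * d = z * c ->
  #|<[a]> <*> <[b]> <*> <[c]> <*> <[d]>| <= 10 * p ^ 2.
Proof.
move=> p0 ap bp c5 d2 /eqP/commgP cab da db Ax Ay Az ca cb dc.
have Na : b \in 'N(<[a]>) by apply: (subsetP (cent_sub _)); rewrite cent_cycle; apply/cent1P/esym.
have cA := card_joing_cycle_le p0 bp Na.
have oa : #|<[a]>| <= p by rewrite dvdn_leq // -orderE order_dvdn ap.
have Nc : c \in 'N(<[a]> <*> <[b]>).
  rewrite -groupV inE conjYg -!cycleJ join_subG !cycle_subG /= !conjgE invgK !mulgA ca cb.
  by rewrite Ax.
have cB := @card_joing_cycle_le (<[a]> <*> <[b]>)%G _ _ (isT : 0 < 5) c5 Nc.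
have Nd : d \in 'N(<[a]> <*> <[b]> <*> <[c]>).
  have dV : d^-1 = d by apply: (mulIg d); rewrite mulVg -d2.
  rewrite inE !conjYg -!cycleJ !join_subG !cycle_subG.
  rewrite (conj_inverted d2 da) (conj_inverted d2 db) !groupV.
  rewrite conjgE dV mulgA dc.
  have sA : <[a]> <*> <[b]> \subset <[a]> <*> <[b]> <*> <[c]> by rewrite joing_subl.
  have Aa : a \in <[a]> <*> <[b]> by rewrite mem_gen // inE cycle_id.
  have Ab : b \in <[a]> <*> <[b]> by rewrite mem_gen // inE cycle_id orbT.
  have Ac : c \in <[a]> <*> <[b]> <*> <[c]> by rewrite mem_gen // inE cycle_id orbT.
  by rewrite (subsetP sA _ Aa) (subsetP sA _ Ab) groupM // (subsetP sA _ Az).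
have := @card_joing_cycle_le (<[a]> <*> <[b]> <*> <[c]>)%G _ _ (isT : 0 < 2) d2 Nd.
move=> /leq_trans; apply.
rewrite (_ : 10 * p ^ 2 = p * p * 5 * 2)%N; last by lia.
by rewrite leq_mul2r /= (leq_trans cB) // leq_mul2r /= (leq_trans cA) // leq_mul2r oa orbT.
Qed.

Lemma bound_cyclic (q k : nat) a b c : (0 < q)%N ->
    a ^+ q = 1 -> b ^+ 5 = 1 -> c ^+ 2 = 1 -> (c * a) ^+ 2 = 1 ->
    [~ c, b] = 1 -> b * a * b^-1 = a ^+ k ->
  #|<[a]> <*> <[b]> <*> <[c]>| <= 10 * q.
Proof.
move=> q0 aq b5 c2 ca /eqP/commgP ccb ba.
have Nb : b \in 'N(<[a]>).
  by rewrite -groupV -cycle_subG norms_cycle conjgE invgK mulgA ba mem_cycle.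
have cA := @card_joing_cycle_le <[a]>%G _ _ (isT : 0 < 5) b5 Nb.
have oa : #|<[a]>| <= q by rewrite dvdn_leq // -orderE order_dvdn aq.
have Nc : c \in 'N(<[a]> <*> <[b]>).
  rewrite inE conjYg -!cycleJ join_subG !cycle_subG (conj_inverted c2 ca) groupV.
  have -> : b ^ c = b by apply/conjg_fixP/commgP/commute_sym.
  by rewrite !mem_gen // inE cycle_id // orbT.
have := @card_joing_cycle_le (<[a]> <*> <[b]>)%G _ _ (isT : 0 < 2) c2 Nc.
move=> /leq_trans; apply.
rewrite (_ : 10 * q = q * 5 * 2)%N; last by lia.
by rewrite leq_mul2r /= (leq_trans cA) // leq_mul2r oa orbT.
Qed.

End Bounds.

Section Presentations.
Local Open Scope group_scope.
Variables (p : nat) (p_pr : prime p) (p_ge11 : (11 <= p)%N).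
Variables (gT : finGroupType) (G : {group gT}).
Hypothesis oG : #|G| = (10 * p ^ 2)%N.
Implicit Types a b c d : gT.

Lemma presented_split_intro (s : 'F_p) e a b c d :
    <[a]> <*> <[b]> <*> <[c]> <*> <[d]> = G ->
    a ^+ p = 1 -> b ^+ p = 1 -> c ^+ 5 = 1 -> d ^+ 2 = 1 -> [~ a, b] = 1 ->
    (d * a) ^+ 2 = 1 -> (d * b) ^+ 2 = 1 ->
    c * a * c^-1 = a ^+ s -> c * b * c^-1 = b ^+ (s ^+ e)%R ->
    d * c * d = a ^+ (1 - s)%R * b ^+ (1 - s ^+ e)%R * c ->
  presented_split s e G.
Proof.
move=> gen ap bp c5 d2 ab da db ca cb dc; apply: isoGrp_card.
  apply/existsP; exists (a, b, c, d); rewrite /= !xpair_eqE /=.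
  by rewrite gen ap bp c5 d2 ab da db ca cb dc !eqxx.
move=> rT H /existsP[[[[a' b'] c'] d']] /eqP[<- ap' bp' c5' d2' ab' da' db' ca' cb' dc'].
rewrite oG; apply: (bound_split (prime_gt0 p_pr) ap' bp' c5' d2' ab' da' db' _ _ _ ca' cb' dc').
- by rewrite mem_gen // inE mem_cycle.
- by rewrite mem_gen // inE mem_cycle orbT.
by rewrite groupM // mem_gen // inE mem_cycle ?orbT.
Qed.

Lemma presented_irreducible_intro (t1 t2 : 'F_p) a b c d :
    <[a]> <*> <[b]> <*> <[c]> <*> <[d]> = G ->
    a ^+ p = 1 -> b ^+ p = 1 -> c ^+ 5 = 1 -> d ^+ 2 = 1 -> [~ a, b] = 1 ->
    (d * a) ^+ 2 = 1 -> (d * b) ^+ 2 = 1 ->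
    c * a * c^-1 = b ^+ t2 -> c * b * c^-1 = (a * b) ^+ t1 ->
    d * c * d = a ^+ (t1 ^+ 2)%R * b ^+ 2 * c ->
  presented_irreducible t1 t2 G.
Proof.
move=> gen ap bp c5 d2 ab da db ca cb dc; apply: isoGrp_card.
  apply/existsP; exists (a, b, c, d); rewrite /= !xpair_eqE /=.
  by rewrite gen ap bp c5 d2 ab da db ca cb dc !eqxx.
move=> rT H /existsP[[[[a' b'] c'] d']] /eqP[<- ap' bp' c5' d2' ab' da' db' ca' cb' dc'].
have Aa : a' \in <[a']> <*> <[b']> by rewrite mem_gen // inE cycle_id.
have Ab : b' \in <[a']> <*> <[b']> by rewrite mem_gen // inE cycle_id orbT.
rewrite oG; apply: (bound_split (prime_gt0 p_pr) ap' bp' c5' d2' ab' da' db' _ _ _ ca' cb' dc').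
- by rewrite groupX.
- by rewrite groupX ?groupM.
by rewrite groupM ?groupX.
Qed.

Lemma presented_cyclic_intro (k : 'Z_(p ^ 2)) a b c :
    <[a]> <*> <[b]> <*> <[c]> = G ->
    a ^+ (p ^ 2) = 1 -> b ^+ 5 = 1 -> c ^+ 2 = 1 -> (c * a) ^+ 2 = 1 ->
    [~ c, b] = 1 -> b * a * b^-1 = a ^+ k ->
  presented_cyclic k G.
Proof.
move=> gen ap b5 c2 ca cb ba; apply: isoGrp_card.
  apply/existsP; exists (a, b, c); rewrite /= !xpair_eqE /=.
  by rewrite gen ap b5 c2 ca cb ba !eqxx.
move=> rT H /existsP[[[a' b'] c']] /eqP[<- ap' b5' c2' ca' cb' ba'].
by rewrite oG; apply: (bound_cyclic _ ap' b5' c2' ca' cb' ba'); rewrite expn_gt0 prime_gt0.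
Qed.

End Presentations.

(** * Presentations of the groups realizing a datum *)

Section Joining.
Local Open Scope group_scope.

Lemma mem_joingl (gT : finGroupType) (x : gT) (C D : {set gT}) :
  x \in C -> x \in C <*> D.
Proof. by move=> Cx; rewrite mem_gen // inE Cx. Qed.

Lemma mem_joing_cycle (gT : finGroupType) (x : gT) (C : {set gT}) :
  x \in C <*> <[x]>.
Proof. by rewrite mem_gen // inE cycle_id orbT. Qed.

Lemma commute_divg (gT : finGroupType) (a b x y : gT) :
  commute x b -> commute x y -> a * b * (x * y)^-1 = a * x^-1 * (b * y^-1).
Proof.
move=> cxb cxy; rewrite cxy invMg -!mulgA; congr (_ * _).
have cVb : x^-1 * b = b * x^-1 by apply/commute_sym/commuteV/commute_sym.
by rewrite (mulgA x^-1) cVb -mulgA.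
Qed.

End Joining.

Section Presented.
Local Open Scope group_scope.
Variables (p : nat) (p_pr : prime p) (p_ge11 : (11 <= p)%N).
Variables (gT : finGroupType) (r l : gT).
Hypotheses (r10 : r ^+ 10 = 1) (l2 : l ^+ 2 = 1).
Hypothesis oG : #|<<[set r; l]>>| = (10 * p ^ 2)%N.
Let u := r ^+ 5 * l.
Let w := u ^ (r ^+ 6).
Let G := <<[set r; l]>>%G.
Let Dp := Fp_cast p_pr.
Let Gr : r \in G. Proof. by rewrite mem_gen ?set21. Qed.
Let Gl : l \in G. Proof. by rewrite mem_gen ?set22. Qed.
Let Gu : u \in G. Proof. by rewrite groupM ?groupX. Qed.
Let Gw : w \in G. Proof. by rewrite groupJ ?groupX. Qed.

(** The generator of order 5 in the presentations: it conjugates, with the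
    convention c x c^-1, by the j-th power of the action of zeta, so that j
    selects the fifth root of unity among the powers of a given one. *)
Definition rot5 (j : nat) := ((r ^+ 6) ^+ j)^-1.

Lemma rot5_conj j x : rot5 j * x * (rot5 j)^-1 = x ^ ((r ^+ 6) ^+ j).
Proof. by rewrite /rot5 invgK conjgE mulgA. Qed.

Let c5 : (r ^+ 6) ^+ 5 = 1.
Proof. by rewrite -expgM (expgM r 10 3) r10 expg1n. Qed.

Lemma rot5_5 j : rot5 j ^+ 5 = 1.
Proof. by rewrite /rot5 expgVn expgAC c5 expg1n invg1. Qed.

Lemma r5_2 : (r ^+ 5) ^+ 2 = 1.
Proof. by rewrite -expgM. Qed.

Lemma rot5_comm j : commute (r ^+ 5) (rot5 j).
Proof. by apply/commuteV; rewrite -expgM; apply: commuteX2. Qed.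

Lemma mem_rot5 j : rot5 j \in G.
Proof. by rewrite groupV !groupX. Qed.

(** For j prime to 5, [rot5 j] generates the same group of order 5 as r^6. *)
Lemma rot5_gen (B : {group gT}) j : ~~ (5 %| j)%N ->
  rot5 j \in B -> r ^+ 6 \in B.
Proof.
move=> j5 Bj; have [m e] : exists m, j * m = 1 %[mod 5].
  have [j1|[j1|[j1|j1]]] : (j %% 5 = 1 \/ j %% 5 = 2 \/ j %% 5 = 3 \/ j %% 5 = 4)%N by lia.
  - by exists 1%N; rewrite -modnMml j1.
  - by exists 3%N; rewrite -modnMml j1.
  - by exists 2%N; rewrite -modnMml j1.
  by exists 4%N; rewrite -modnMml j1.
have -> : r ^+ 6 = ((rot5 j)^-1) ^+ m.
  by rewrite /rot5 invgK -expgM -(expg_mod _ c5) e (expg_mod 1 c5).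
by apply: groupX; rewrite groupV.
Qed.

(** With d inverting a and b and commuting with c, the involution
    d (a b)^-1 conjugates c as the presentations require. *)
Lemma twisted_involution (a b c d x y : gT) :
    d ^+ 2 = 1 -> a ^ d = a^-1 -> b ^ d = b^-1 -> commute a b -> commute d c ->
    c * a * c^-1 = x -> c * b * c^-1 = y -> 
  let d' := d * (a * b)^-1 in
  [/\ d' ^+ 2 = 1, (d' * a) ^+ 2 = 1, (d' * b) ^+ 2 = 1
    & d' * c * d' = a * b * (x * y)^-1 * c].
Proof.
move=> d2 ad bd cab cdc ca cb d'.
have inv2 z : z ^ d = z^-1 -> (d * z) ^+ 2 = 1.
  move=> zd; rewrite expgS expg1 mulgA -(mulgA d z d).
  have -> : z * d = d * z^-1 by rewrite -zd conjgE !mulgA mulgV mul1g.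
  by rewrite mulgA -[d * d]/(d ^+ 2) d2 mul1g mulVg.
have abd : (a * b) ^ d = (a * b)^-1.
  by rewrite conjMg ad bd -invMg cab.
have abVd : ((a * b)^-1) ^ d = (a * b)^-1^-1 by rewrite conjVg abd.
have d'a : d' * a = d * b^-1 by rewrite /d' invMg !mulgA mulgKV.
have d'b : d' * b = d * a^-1 by rewrite /d' cab invMg !mulgA mulgKV.
split.
- exact: inv2.
- by rewrite d'a; apply: inv2; rewrite conjVg bd.
- by rewrite d'b; apply: inv2; rewrite conjVg ad.
have ce : c * (a * b)^-1 = (x * y)^-1 * c.
  have -> : (x * y)^-1 = c * (a * b)^-1 * c^-1.
    by rewrite -ca -cb !invMg !invgK !mulgA !mulgKV.
  by rewrite mulgKV.
have dd z : z * d * d = z by rewrite -mulgA -[d * d]/(d ^+ 2) d2 mulg1.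
have dV : d^-1 = d by apply: (mulIg d); rewrite mulVg -d2.
have de : d' = a * b * d.
  have : (a * b)^-1 ^ d = a * b by rewrite conjVg abd invgK.
  by rewrite conjgE dV => <-; rewrite mulgA dd.
by rewrite {1}de /d' mulgA -(mulgA _ d c) cdc mulgA dd -mulgA ce mulgA.
Qed.

(** The involution d gives back r^5 = d a b, then rot5 j gives r^6, hence r, and
    u gives l. *)
Lemma gen_twisted (a b d : gT) j : a \in G -> b \in G -> ~~ (5 %| j)%N ->
    d = r ^+ 5 * (a * b)^-1 -> u \in <[a]> <*> <[b]> ->
  <[a]> <*> <[b]> <*> <[rot5 j]> <*> <[d]> = G.
Proof.
move=> Ga Gb j5 Dd ABu; set B := (X in X = _).
have Ba : a \in B by do 3!apply: mem_joingl; apply: cycle_id.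
have Bb : b \in B by do 2!apply: mem_joingl; apply: mem_joing_cycle.
have Bj : rot5 j \in B by apply: mem_joingl; apply: mem_joing_cycle.
have Bd : d \in B by apply: mem_joing_cycle.
have Bu : u \in B by do 2!apply: mem_joingl.
have B6 : r ^+ 6 \in B by apply: (@rot5_gen B%G j).
have B5 : r ^+ 5 \in B.
  have -> : r ^+ 5 = d * (a * b) by rewrite Dd mulgKV.
  by rewrite !groupM.
have Br : r \in B.
  have -> : r = r ^+ 5 * r ^+ 6 by rewrite -expgD (expgD r 10 1) r10 mul1g.
  by rewrite groupM.
have Bl : l \in B.
  have -> : l = r ^+ 5 * u by rewrite mulgA -expgD r10 mul1g.
  by rewrite groupM.
apply/eqP; rewrite eqEsubset; apply/andP; split; last first.
  by rewrite gen_subG subUset !sub1set Br Bl.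
rewrite !join_subG !cycle_subG Ga Gb mem_rot5 Dd.
by rewrite groupM ?groupX // groupV groupM.
Qed.

Lemma presented_cyclic_of (k0 : 'Z_(p ^ 2)) j : ~~ (5 %| j)%N ->
  realizes (Cyc k0) r l -> presented_cyclic (k0 ^+ j)%R G.
Proof.
move=> j5 [u1 uc]; have D2 := p2_cast p_ge11.
have u5 := gen_inverted r10 l2; rewrite -/u in u1 uc u5.
have uj i : u ^ ((r ^+ 6) ^+ i) = u ^+ (k0 ^+ i)%R.
  elim: i => [|i IH]; first by rewrite conjg1 (expgZ_nat D2 1).
  by rewrite expgSr conjgM IH conjXg uc -(expgZM D2) // GRing.exprS.
apply: (@presented_cyclic_intro _ p_pr _ G oG _ u (rot5 j) (r ^+ 5)) => //.
- set B := (X in X = _).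
  have Bu : u \in B by do 2!apply: mem_joingl; apply: cycle_id.
  have Bj : rot5 j \in B by apply: mem_joingl; apply: mem_joing_cycle.
  have B5 : r ^+ 5 \in B by apply: mem_joing_cycle.
  have B6 : r ^+ 6 \in B by apply: (@rot5_gen B%G j).
  have Br : r \in B.
    have -> : r = r ^+ 5 * r ^+ 6 by rewrite -expgD (expgD r 10 1) r10 mul1g.
    by rewrite groupM.
  have Bl : l \in B.
    have -> : l = r ^+ 5 * u by rewrite mulgA -expgD r10 mul1g.
    by rewrite groupM.
  apply/eqP; rewrite eqEsubset; apply/andP; split; last first.
  by rewrite gen_subG subUset !sub1set Br Bl.
  by rewrite !join_subG !cycle_subG Gu mem_rot5 groupX.
- exact: rot5_5.
- exact: r5_2.
- by rewrite mulgA -expgD r10 mul1g l2.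
- by apply/eqP/commgP/rot5_comm.
by rewrite rot5_conj uj.
Qed.

Section Quad.
Variables t n : 'F_p.
Hypothesis Rd : realizes (Quad t n) r l.
Let L (a b : 'F_p) := lin u w a b.
Let up : u ^+ p = 1. Proof. by case: Rd. Qed.
Let wp : w ^+ p = 1. Proof. by rewrite -conjXg up conj1g. Qed.
Let cuw : commute u w. Proof. by case: Rd. Qed.
Let w01 : w = L 0%R 1%R. Proof. by rewrite /L lin01. Qed.
Let u10 : u = L 1%R 0%R. Proof. by rewrite /L lin10. Qed.

Lemma lin_conj a b : L a b ^ (r ^+ 6) = L (- n * b)%R (a + t * b)%R.
Proof.
have uc : u ^ (r ^+ 6) = L 0%R 1%R by rewrite -w01.
have wc : w ^ (r ^+ 6) = L (- n)%R t.
  by case: Rd => _ _ ->; rewrite /L /lin; apply: commuteX2; apply: commute_sym.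
by rewrite [LHS](linJ p_pr up wp cuw uc wc); congr lin; ring.
Qed.

Lemma lin_inverted a b : L a b ^ (r ^+ 5) = (L a b)^-1.
Proof.
have uV : u ^ (r ^+ 5) = L (- 1)%R 0%R.
  by rewrite (gen_inverted r10 l2) -/u u10 /L linN // GRing.oppr0.
have wV : w ^ (r ^+ 5) = L 0%R (- 1)%R.
  rewrite (inverted_conj6 (gen_inverted r10 l2)) -/u -/w w01 /L linN //.
  by rewrite GRing.oppr0.
by rewrite [LHS](linJ p_pr up wp cuw uV wV) /L linN //; congr lin; ring.
Qed.

Lemma mem_lin a b : L a b \in G.
Proof. by rewrite groupM ?groupX. Qed.

End Quad.

(** The elements a and b are eigenvectors for x and x^e; they span since
    x != x^e. *)
Lemma presented_split_of (x : 'F_p) e j : ~~ (5 %| j)%N -> x != (x ^+ e)%R ->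
  realizes (eigen_datum x e) r l -> presented_split (x ^+ j)%R e G.
Proof.
move=> j5 xe Rd; have [up cuw _] := Rd; rewrite -/u -/w in up cuw.
have wp : w ^+ p = 1 by rewrite -conjXg up conj1g.
pose a := lin u w (- x ^+ e)%R 1%R; pose b := lin u w (- x)%R 1%R.
have Jpow (y : gT) (z : 'F_p) i : y ^+ p = 1 -> y ^ (r ^+ 6) = y ^+ z ->
    y ^ ((r ^+ 6) ^+ i) = y ^+ (z ^+ i)%R.
  move=> yp yz; elim: i => [|i IH]; first by rewrite conjg1 (expgZ_nat Dp 1).
  by rewrite expgSr conjgM IH conjXg yz -(expgZM Dp) // GRing.exprS.
have ap : a ^+ p = 1 by apply: linp.
have bp : b ^+ p = 1 by apply: linp.
have cab : commute a b by apply: lin_comm.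
have ax : a ^ (r ^+ 6) = a ^+ x.
  by rewrite (lin_conj Rd) linX //; congr lin; rewrite ?GRing.exprS; ring.
have bx : b ^ (r ^+ 6) = b ^+ (x ^+ e)%R.
  by rewrite (lin_conj Rd) linX //; congr lin; rewrite ?GRing.exprS; ring.
have ca : rot5 j * a * (rot5 j)^-1 = a ^+ (x ^+ j)%R by rewrite rot5_conj (Jpow _ _ _ ap ax).
have cb : rot5 j * b * (rot5 j)^-1 = b ^+ ((x ^+ j) ^+ e)%R.
  by rewrite rot5_conj (Jpow _ _ _ bp bx) GRing.exprAC.
have [d2 da db dcd] := twisted_involution r5_2 (lin_inverted Rd _ _)
  (lin_inverted Rd _ _) cab (rot5_comm j) ca cb.
apply: (presented_split_intro p_pr oG _ ap bp (rot5_5 j) d2 _ da db ca cb).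
- apply: (gen_twisted _ _ j5 erefl); try exact: mem_lin.
  have -> : u = (a * b^-1) ^+ ((x - x ^+ e)^-1)%R.
    rewrite /a /b linN // linD // linX // -[LHS](lin10 p_pr w up); congr lin.
      by rewrite GRing.opprK [(- _ + _)%R]GRing.addrC GRing.mulfV // GRing.subr_eq0.
    by rewrite GRing.subrr GRing.mul0r.
  by rewrite groupX // groupM ?groupV // mem_gen // inE cycle_id ?orbT.
- exact/eqP/commgP.
rewrite dcd; congr (_ * _).
rewrite commute_divg; last 2 first.
- exact/commute_sym/commuteX/commute_sym.
- exact/commuteX2.
by rewrite !(expgZD Dp) // !(expgZN Dp) // !(expgZ_nat Dp 1).
Qed.

(** The two roots differ because 5 is not 0 modulo p, so that t2 = -1 - t1. *)
Lemma golden_roots (t1 t2 : 'F_p) :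
    [set y : 'F_p | (y ^+ 2 + y - 1 == 0)%R] = [set t1; t2] ->
  (t1 ^+ 2 = 1 - t1)%R /\ t2 = (- 1 - t1)%R.
Proof.
move=> roots; have rootP y : ((y ^+ 2 + y - 1 == 0) = (y \in [set t1; t2]))%R.
  by rewrite -roots inE.
have t1_0 : (t1 ^+ 2 + t1 - 1 = 0)%R by apply/eqP; rewrite rootP set21.
have t1_2 : (t1 ^+ 2 = 1 - t1)%R.
  by rewrite -[RHS]GRing.addr0 -t1_0; ring.
split=> //; have : (- 1 - t1)%R \in [set t1; t2].
  by rewrite -rootP; apply/eqP; rewrite -[RHS]t1_0; ring.
case/set2P => // e; have : (5%:R == 0 :> 'F_p)%R.
  apply/eqP; transitivity ((t1 - (- 1 - t1)) ^+ 2 - 4%:R * (t1 ^+ 2 + t1 - 1))%R; first by ring.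
  by rewrite t1_0 e; ring.
by rewrite -(GRing.dvdn_pcharf (pchar_Fp p_pr)) => /dvdn_leq; lia.
Qed.

(** The case where the action of zeta^j has the minimal polynomial
    X^2 - t1 X + 1: take a = u and b = (zeta^j u)^(-t1), as t1 t2 = -1. *)
Lemma presented_irreducible_pow (t t1 x y : 'F_p) j :
    ~~ (5 %| j)%N -> realizes (Quad t 1%R) r l -> (t1 ^+ 2 = 1 - t1)%R ->
    u ^ ((r ^+ 6) ^+ j) = lin u w x y ->
    lin u w x y ^ ((r ^+ 6) ^+ j) = lin u w (t1 * x - 1)%R (t1 * y)%R ->
  presented_irreducible t1 (- 1 - t1)%R G.
Proof.
move=> j5 Rd t12 uj wj; have [up cuw _] := Rd; rewrite -/u -/w in up cuw.
have wp : w ^+ p = 1 by rewrite -conjXg up conj1g.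
have u10 : u = lin u w (1%R : 'F_p) 0%R by rewrite lin10.
pose b := lin u w (- t1 * x)%R (- t1 * y)%R.
have Db : b = lin u w x y ^+ (- t1)%R by rewrite linX //; congr lin; ring.
have bp : b ^+ p = 1 by apply: linp.
have cub : commute u b by rewrite {1}u10; apply: lin_comm.
have ca : rot5 j * u * (rot5 j)^-1 = b ^+ (- 1 - t1)%R.
  rewrite rot5_conj uj linX //; congr lin.
    transitivity (x * (t1 ^+ 2 + t1))%R; last by ring.
    by rewrite t12; ring.
  transitivity (y * (t1 ^+ 2 + t1))%R; last by ring.
  by rewrite t12; ring.
have cb : rot5 j * b * (rot5 j)^-1 = (u * b) ^+ t1.
  rewrite rot5_conj Db conjXg wj -Db [u in RHS]u10 linD // !linX //.
  by congr lin; ring.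
have [d2 da db dcd] := twisted_involution r5_2 (gen_inverted r10 l2)
  (lin_inverted Rd _ _) cub (rot5_comm j) ca cb.
apply: (presented_irreducible_intro p_pr oG _ up bp (rot5_5 j) d2 _ da db ca cb).
- apply: (gen_twisted Gu _ j5 erefl); first exact: mem_lin.
  by apply: mem_joingl; apply: cycle_id.
- exact/eqP/commgP.
rewrite dcd; congr (_ * _).
rewrite -(expgZ_nat Dp 2 bp) /b.
rewrite -/u [u in (u * _) ^+ _]u10 [X in X * _ * _^-1]u10 [X in X ^+ (t1 ^+ 2)%R]u10.
rewrite !linD // !linX // !linD // linN // !linD //.
by congr lin; [rewrite t12|]; ring.
Qed.

(** The roots are z + z^-1 and z^2 + z^-2, so that if t is not t1 then the
    square of the action has the trace t1. *)
Lemma presented_irreducible_of (t t1 t2 : 'F_p) :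
    [set y : 'F_p | (y ^+ 2 + y - 1 == 0)%R] = [set t1; t2] ->
    (t ^+ 2 + t - 1 = 0)%R -> realizes (Quad t 1%R) r l ->
  presented_irreducible t1 t2 G.
Proof.
move=> roots t0 Rd; have [up cuw wE] := Rd; rewrite -/u -/w in up cuw.
have wp : w ^+ p = 1 by rewrite -conjXg up conj1g.
have [t12 Dt2] := golden_roots roots.
have u10 : u = lin u w (1%R : 'F_p) 0%R by rewrite lin10.
have w01 : w = lin u w (0%R : 'F_p) 1%R by rewrite lin01.
have : t \in [set t1; t2] by rewrite -roots inE t0.
rewrite Dt2; case/set2P => Dt.
  apply: (@presented_irreducible_pow t t1 0%R 1%R 1) => //.
  by rewrite expg1 (lin_conj Rd) Dt; congr lin; ring.
apply: (@presented_irreducible_pow t t1 (- 1)%R t 2) => //.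
- transitivity (w ^ (r ^+ 6)); first by rewrite expgS expg1 conjgM.
  by rewrite {1}w01 (lin_conj Rd); congr lin; ring.
rewrite expgS expg1 conjgM !(lin_conj Rd) Dt; congr lin.
  transitivity (1 - (t1 ^+ 2 + 2%:R * t1 + 1))%R; first by ring.
  by rewrite t12; ring.
transitivity (1 - t1 - 3%:R * t1 ^+ 2 - t1 ^+ 3)%R; first by ring.
have t13 : (t1 ^+ 3 = t1 - t1 ^+ 2)%R by rewrite GRing.exprS {1}t12; ring.
rewrite t13.
transitivity (1 - 2%:R * t1 - 2%:R * t1 ^+ 2)%R; first by ring.
by transitivity (- t1 ^+ 2 - t1)%R; [rewrite t12|]; ring.
Qed.

End Presented.

(** * Maps realizing a datum *)

Definition datum_code p (d : datum p) : 'Z_(p ^ 2) + 'F_p * 'F_p :=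
  match d with Cyc k => inl k | Quad t n => inr (t, n) end.

Definition datum_decode p (c : 'Z_(p ^ 2) + 'F_p * 'F_p) : datum p :=
  match c with inl k => Cyc k | inr (t, n) => Quad t n end.

Lemma datum_codeK p : cancel (@datum_code p) (@datum_decode p).
Proof. by case. Qed.

HB.instance Definition _ p :=
  Equality.copy (datum p) (can_type (@datum_codeK p)).

Section MapData.
Local Open Scope group_scope.
Variables (p : nat) (p_pr : prime p) (p_ge11 : (11 <= p)%N).
Let Dp := Fp_cast p_pr.
Let D2 := p2_cast p_ge11.
Implicit Types (d : datum p) (M N : oriented_map).

(** Replacing r by its inverse keeps u, as r^5 is an involution, and inverts the
    action of zeta. *)
Lemma realizes_cycV (gT : finGroupType) (r l : gT) (k k' : 'Z_(p ^ 2)) :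
    r ^+ 10 = 1 -> (k * k' = 1)%R ->
  realizes (Cyc k : datum p) r l -> realizes (Cyc k' : datum p) r^-1 l.
Proof.
move=> r10 kk'; rewrite /realizes; cbv zeta; rewrite !expgVn.
have -> : (r ^+ 5)^-1 = r ^+ 5 by apply: (mulIg (r ^+ 5)); rewrite mulVg -expgD.
move: (_ * l) (r ^+ 6) => u c [u1 uc]; split=> //.
apply: (canLR (conjgK _)).
by rewrite conjXg uc -(expgZM D2) // kk' (expgZ_nat D2 1).
Qed.

(** The reciprocal polynomial of X^2 - t X + n. *)
Lemma realizes_quadV (gT : finGroupType) (r l : gT) (t n n' : 'F_p) :
    r ^+ 10 = 1 -> (n * n' = 1)%R ->
  realizes (Quad t n) r l -> realizes (Quad (t * n')%R n') r^-1 l.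
Proof.
move=> r10 nn'; rewrite /realizes; cbv zeta; rewrite !expgVn.
have -> : (r ^+ 5)^-1 = r ^+ 5 by apply: (mulIg (r ^+ 5)); rewrite mulVg -expgD.
move: (_ * l) (r ^+ 6) => u c [u1 cuw wE].
set v := u ^ c^-1; have vp : v ^+ p = 1 by rewrite -conjXg u1 conj1g.
set z := v ^ c^-1; have zp : z ^+ p = 1 by rewrite -conjXg vp conj1g.
have cvu : commute v u.
  have := congr1 (conjg^~ c^-1) cuw.
  by rewrite /= (conjMg u (u ^ c)) (conjMg (u ^ c) u) conjgK -/v.
split=> //.
have uE : u = v ^+ t * z ^+ (- n)%R.
  have := congr1 (fun x => (x ^ c^-1) ^ c^-1) wE; rewrite /= !conjgK => {1}->.
  rewrite (conjMg ((u ^ c) ^+ t)) (conjMg (((u ^ c) ^+ t) ^ c^-1)).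
  rewrite (conjXg (u ^ c)) (conjXg u) conjgK (conjXg u) -/v (conjXg v) -/z.
  by [].
have zE : z ^+ (- n)%R = v ^+ (- t)%R * u.
  by rewrite {1}uE (expgZN Dp t vp) mulKg.
have -> : z = z ^+ (- n)%R ^+ (- n')%R.
  by rewrite -(expgZM Dp) // GRing.mulrNN nn' (expgZ_nat Dp 1).
rewrite zE expgMn; last exact/commute_sym/commuteX/commute_sym.
by rewrite -(expgZM Dp) // GRing.mulrNN.
Qed.

Lemma map10_rot M : regular_map10 p M -> rotation M ^+ 10 = 1.
Proof. by case=> _ _ <- _; apply: expg_order. Qed.

Lemma map10_rev M : reversal M ^+ 2 = 1.
Proof. by rewrite expgS expg1 -{2}reversalV mulgV. Qed.

Lemma map10_card M : regular_map10 p M ->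
  #|<<[set rotation M; reversal M]>>| = (10 * p ^ 2)%N.
Proof. by case=> rM cM _ _; rewrite -cM -card_monodromy. Qed.

Definition map_realizes d M := realizes d (rotation M) (reversal M).

(** The relations bound the order of the diagonal subgroup by the order of either
    monodromy group. *)
Lemma map_realizes_iso d M N : regular_map10 p M -> regular_map10 p N ->
  map_realizes d M -> map_realizes d N -> map_iso M N.
Proof.
move=> hM hN dM dN; have [rM cM _ _] := hM; have [rN cN _ _] := hN.
have [|f [fr fl]] := @diagonal_morphism _ _ (rotation M) (reversal M)
    (rotation N) (reversal N).
  rewrite (map10_card hM); apply: (realizes_card_le _ _ (prime_gt0 p_pr) (realizes_pair dM dN)).
    by rewrite expg_pair !map10_rot.
  by rewrite expg_pair !map10_rev.
apply: (@morphism_map_iso M N f) => //.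
by rewrite !card_arcs // cM cN.
Qed.

Lemma map_iso_realizes d M N : map_iso M N -> map_realizes d M -> map_realizes d N.
Proof.
case/map_iso_morphism=> f [_ fr fl] dM; rewrite /map_realizes -fr -fl.
by apply: (@morph_realizes _ _ _ _ [set: {perm arcs M}]%G f) => //; rewrite inE.
Qed.

Lemma map_realizes_inj d d' M : regular_map10 p M ->
  map_realizes d M -> map_realizes d' M -> d = d'.
Proof.
move=> hM; apply: (realizes_inj p_pr p_ge11 (map10_rot hM) (map10_rev M)).
exact: map10_card.
Qed.

Lemma map_realizes_exists M : regular_map10 p M ->
  exists2 d, admissible d & map_realizes d M.
Proof.
move=> hM; have [_ _ o10 rl5] := hM.
exact: (realizes_exists p_pr p_ge11 (map10_rot hM) (map10_rev M) (map10_card hM)).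
Qed.

Lemma map_exists d : admissible d -> exists2 M, regular_map10 p M & map_realizes d M.
Proof. by case: d => [k|t n] ad; [apply: cyc_model|apply: quad_model]. Qed.

Lemma classified_data (ds : seq (datum p)) (Ms : seq oriented_map) (d0 : datum p) :
    size Ms = size ds -> uniq ds ->
    (forall M0 i, (i < size ds)%N ->
       regular_map10 p (nth M0 Ms i) /\ map_realizes (nth d0 ds i) (nth M0 Ms i)) ->
    (forall d, admissible d -> d \in ds) ->
  classified (regular_map_of (- (2 * p ^ 2)%:Z)%R (10 * p ^ 2)) (size ds) Ms.
Proof.
move=> szM uds Mds cover; have p0 := prime_gt0 p_pr.
have op : odd p by case: (even_prime p_pr) p_ge11 => [->|].
split=> // [M0 i ltin|M0 i j ltin ltjn|M0 M /(regular_map_of10 op)].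
- by apply: regular_map10_of; case: (Mds M0 i ltin).
- have [hi ri] := Mds M0 i ltin; have [hj rj] := Mds M0 j ltjn.
  case=> [isoM|/(regular_map10_dual_iso hi hj)//].
  apply/eqP; rewrite -(nth_uniq d0 ltin ltjn uds); apply/eqP.
  exact: map_realizes_inj hj (map_iso_realizes isoM ri) rj.
have cov N : regular_map10 p N -> exists2 i, (i < size ds)%N & map_iso N (nth M0 Ms i).
  move=> hN; have [d ad dN] := map_realizes_exists hN.
  have dds := cover _ ad; exists (index d ds); first by rewrite index_mem.
  have [hi ri] := Mds M0 _ (etrans (index_mem d ds) dds).
  by apply: (map_realizes_iso hN hi dN); move: ri; rewrite nth_index.
case=> hM; have [i ltin isoM] := cov _ hM; exists i => //; first by left.
right; apply: map_iso_trans (map_iso_dualK M) _; exact: map_iso_dual.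
Qed.

Lemma map10_reflexive t M : regular_map10 p M -> map_realizes (Quad t 1%R) M ->
  reflexive_map M.
Proof.
move=> hM dM; apply/reflexive_mirror.
apply: (map_realizes_iso hM (regular_map10_mirror hM) dM).
rewrite -[t]GRing.mulr1; apply: realizes_quadV dM; first exact: map10_rot.
exact: GRing.mulr1.
Qed.

Lemma map_cyc_presented (k k' : 'Z_(p ^ 2)) M : phi5 k = 0%R ->
    (5.-primitive_root k')%R -> regular_map10 p M -> map_realizes (Cyc k) M ->
  presented_cyclic k' (autp M).
Proof.
move=> k0 pk' hM dM; have [rM _ _ _] := hM.
have k'0 : phi5 k' = 0%R.
  apply: phi5_Zp2 => //; first exact: prim_expr_order.
  by rewrite -[k']GRing.expr1 -(prim_order_dvd pk').
have [j j5 ->] := phi5_roots_Zp2 p_pr p_ge11 k0 k'0.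
apply: isoGrp_trans (autp_isog rM) _.
apply: (presented_cyclic_of p_pr p_ge11 (map10_rot hM) (map10_rev M) (map10_card hM) _ dM).
by lia.
Qed.

Lemma map_eigen_presented (x s : 'F_p) e M : phi5 x = 0%R ->
    ~~ (5 %| e.-1)%N -> (0 < e)%N ->
    (5.-primitive_root s)%R -> regular_map10 p M -> map_realizes (eigen_datum x e) M ->
  presented_split s e (autp M).
Proof.
move=> x0 e5 e0 ps hM dM; have [rM _ _ _] := hM.
have n5 : (5%:R != 0 :> 'F_p)%R by apply: natF_neq0.
have s0 : phi5 s = 0%R.
  apply: prim_phi5_field; first exact: prim_expr_order.
  by rewrite -[s]GRing.expr1 -(prim_order_dvd ps).
have [j j5 ->] := phi5_roots_Fp p_pr p_ge11 x0 s0.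
apply: isoGrp_trans (autp_isog rM) _.
apply: (presented_split_of p_pr p_ge11 (map10_rot hM) (map10_rev M) (map10_card hM) _ _ dM).
  by lia.
by rewrite -{1}[x]GRing.expr1 (eq_prim_root_expr (phi5_prim n5 x0)); lia.
Qed.

Lemma map_golden_presented (t t1 t2 : 'F_p) M :
    [set y : 'F_p | (y ^+ 2 + y - 1 == 0)%R] = [set t1; t2] ->
    (t ^+ 2 + t - 1 = 0)%R -> regular_map10 p M -> map_realizes (Quad t 1%R) M ->
  presented_irreducible t1 t2 (autp M).
Proof.
move=> roots t0 hM dM; have [rM _ _ _] := hM.
apply: isoGrp_trans (autp_isog rM) _.
exact: (presented_irreducible_of p_pr p_ge11 (map10_rot hM) (map10_rev M) (map10_card hM) roots t0 dM).
Qed.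

End MapData.

(** * The two classifications *)

Section Cases.
Variables (p : nat) (p_pr : prime p) (p_ge11 : (11 <= p)%N).
Local Open Scope ring_scope.

Lemma Cyc_eqE (k k' : 'Z_(p ^ 2)) : (Cyc k == Cyc k' :> datum p) = (k == k').
Proof. by apply/eqP/eqP => [[]|->]. Qed.

Lemma Quad_eqE (t n t' n' : 'F_p) :
  (Quad t n == Quad t' n') = (t == t') && (n == n').
Proof. by apply/eqP/andP => [[-> ->]|[/eqP-> /eqP->]]. Qed.

Lemma Cyc_QuadE (k : 'Z_(p ^ 2)) (t n : 'F_p) : (Cyc k == Quad t n) = false.
Proof. by apply/eqP. Qed.

Lemma Quad_CycE (k : 'Z_(p ^ 2)) (t n : 'F_p) : (Quad t n == Cyc k) = false.
Proof. by apply/eqP. Qed.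

Lemma five_neq0 : (5%:R : 'F_p) != 0.
Proof. exact: (natF_neq0 p_pr p_ge11 (m := 5)). Qed.

(** The discriminant of y^2 + y - 1 is 5. *)
Lemma golden_neq (t : 'F_p) : t ^+ 2 + t - 1 = 0 -> t != - 1 - t.
Proof.
move=> t0; apply/eqP => e; case/eqP: five_neq0.
transitivity ((t - (- 1 - t)) ^+ 2 - 4%:R * (t ^+ 2 + t - 1)); first by ring.
by rewrite t0 -e; ring.
Qed.

Lemma golden_root (t t' : 'F_p) : t ^+ 2 + t - 1 = 0 -> t' ^+ 2 + t' - 1 = 0 ->
  t' = t \/ t' = - 1 - t.
Proof.
move=> t0 t0'; have : (t' - t) * (t' - (- 1 - t)) = 0.
  transitivity ((t' ^+ 2 + t' - 1) - (t ^+ 2 + t - 1)); first by ring.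
  by rewrite t0 t0' subr0.
by move/eqP; rewrite mulf_eq0 !subr_eq0 => /orP[]/eqP->; [left|right].
Qed.

Lemma maps_minus1_mod5 : (p %% 5 = 4)%N ->
  exists R1 R2 : oriented_map,
    [/\ classified (regular_map_of (- (2 * p ^ 2)%:Z)%R (10 * p ^ 2)) 2 [:: R1; R2],
        reflexive_map R1, reflexive_map R2
      & forall t1 t2 : 'F_p,
          [set y : 'F_p | (y ^+ 2 + y - 1 == 0)%R] = [set t1; t2] ->
          presented_irreducible t1 t2 (autp R1)
          /\ presented_irreducible t1 t2 (autp R2)].
Proof.
move=> p4; have [t t0] := golden_Fp p_pr p_ge11 p4.
have t0' : (- 1 - t) ^+ 2 + (- 1 - t) - 1 = 0 by rewrite -[RHS]t0; ring.
have [R1 h1 d1] := map_exists p_pr p_ge11 (admissible_golden t0).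
have [R2 h2 d2] := map_exists p_pr p_ge11 (admissible_golden t0').
exists R1, R2; split.
- apply: (@classified_data p p_pr p_ge11 [:: Quad t 1; Quad (- 1 - t) 1] _ (Quad t 1)) => //.
  + by rewrite /= inE Quad_eqE negb_and (golden_neq t0).
  + by move=> M0 [|[|i]].
  case=> [k /(no_phi5_Zp2 p_pr p_ge11 p4)//|t' n /admissible_quad].
  case=> [[-> /(golden_root t0)[] ->]|[/(no_phi5_Fp p_pr p_ge11 p4)]] //.
    by rewrite !inE eqxx.
  by rewrite !inE eqxx orbT.
- exact: map10_reflexive h1 d1.
- exact: map10_reflexive h2 d2.
move=> t1 t2 roots; split.
  exact: map_golden_presented roots t0 h1 d1.
exact: map_golden_presented roots t0' h2 d2.
Qed.

Section FifthRoots.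
Variables (s : 'F_p) (k : 'Z_(p ^ 2)).
Hypotheses (s0 : phi5 s = 0) (k0 : phi5 k = 0).

Let ps : 5.-primitive_root s := phi5_prim five_neq0 s0.

Let pk : 5.-primitive_root k.
Proof. by apply: phi5_prim k0; apply: (natZ_neq0 p_ge11 (m := 5)). Qed.

Lemma eigen_eqF i j e f : (i * e.+1 == j * f.+1 %[mod 5])%N = false ->
  (eigen_datum (s ^+ i) e == eigen_datum (s ^+ j) f) = false.
Proof.
move=> ij; rewrite Quad_eqE -!exprM.
by rewrite [X in _ && X](eq_prim_root_expr ps) ij andbF.
Qed.

Definition eigen_pow i e : datum p := eigen_datum (s ^+ i) e.
Definition cyc_pow i : datum p := Cyc (k ^+ i).
(** Two reflexive maps, two chiral pairs with a cyclic Sylow p-subgroup and two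
    with an elementary abelian one. *)
Definition eigen_data : seq (datum p) :=
  [:: eigen_pow 1 4; eigen_pow 2 4; cyc_pow 1; cyc_pow 4; cyc_pow 2; cyc_pow 3;
      eigen_pow 1 2; eigen_pow 4 2; eigen_pow 2 2; eigen_pow 3 2].

Lemma eigen_pow4 i : eigen_pow i 4 = Quad (s ^+ i + s ^+ (i * 4)) 1.
Proof.
by rewrite /eigen_pow /eigen_datum -!exprM; congr Quad; rewrite mulnC exprM (phi5_expr5 s0) expr1n.
Qed.

Lemma eigen_pow_golden i : ~~ (5 %| i)%N ->
  (s ^+ i + s ^+ (i * 4)) ^+ 2 + (s ^+ i + s ^+ (i * 4)) - 1 = 0.
Proof.
move=> i5; have x0 := phi5X s0 i5; rewrite exprM; move: (s ^+ i) x0 => x x0.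
transitivity (phi5 x + x ^+ 3 * (x ^+ 5 - 1) + 2%:R * (x ^+ 5 - 1)); first by rewrite /phi5; ring.
by rewrite x0 (phi5_expr5 x0); ring.
Qed.

Lemma uniq_eigen_data : uniq eigen_data.
Proof.
have kE i j : (cyc_pow i == cyc_pow j) = (i == j %[mod 5])%N.
  by rewrite Cyc_eqE (eq_prim_root_expr pk).
have eF i j e f : (i * e.+1 == j * f.+1 %[mod 5])%N = false -> (eigen_pow i e == eigen_pow j f) = false.
  exact: eigen_eqF.
have CE i j e : (cyc_pow i == eigen_pow j e) = false by apply: Cyc_QuadE.
have EC i j e : (eigen_pow i e == cyc_pow j) = false by apply: Quad_CycE.
have E12 : (eigen_pow 1 4 == eigen_pow 2 4) = false.
  rewrite !eigen_pow4 Quad_eqE andbT; apply/negbTE.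
  suff -> : s ^+ 2 + s ^+ (2 * 4) = - 1 - (s ^+ 1 + s ^+ (1 * 4)).
    by apply: golden_neq; apply: eigen_pow_golden.
  rewrite (phi5_mod (2 * 4) s0) /=; apply/eqP; rewrite -subr_eq0; apply/eqP.
  by rewrite -[RHS]s0 /phi5; ring.
by rewrite /= !inE E12 !CE !EC !kE !eF.
Qed.

(** In the second case of [admissible_quad] the roots of the polynomial are n^2
    and n^4, of product n. *)
Lemma mem_eigen_data d : admissible d -> d \in eigen_data.
Proof.
case: d => [k' k'0|t n ad].
  have [j + ->] := phi5_roots_Zp2 p_pr p_ge11 k0 k'0.
  by case: j => [|[|[|[|[|j]]]]] // _; rewrite !inE !eqxx ?orbT.
case: (admissible_quad ad) => [[-> t0]|[n0 tn]].
  have [->|->] := golden_root (eigen_pow_golden (isT : ~~ (5 %| 1))%N) t0.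
    by rewrite -eigen_pow4 !inE eqxx.
  have -> : - 1 - (s ^+ 1 + s ^+ (1 * 4)) = s ^+ 2 + s ^+ (2 * 4).
    rewrite (phi5_mod (2 * 4) s0) /=; apply/eqP; rewrite -subr_eq0; apply/eqP.
    by rewrite -[RHS]oppr0 -[X in _ = - X]s0 /phi5; ring.
  by rewrite -eigen_pow4 !inE eqxx orbT.
have n1 : 1 + n != 0.
  apply/eqP => n1; have nm : n = - 1 by apply/eqP; rewrite -subr_eq0 opprK addrC n1.
  by have /eqP := n0; rewrite nm (_ : phi5 (-1) = 1) ?oner_eq0 // /phi5; ring.
have n5 := phi5_expr5 n0.
have -> : Quad t n = eigen_datum (n ^+ 2) 2.
  rewrite /eigen_datum -!exprM (phi5_mod (2 * 3) n0) expr1; congr Quad.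
  apply: (mulIf n1); rewrite tn; apply/eqP; rewrite eq_sym -subr_eq0; apply/eqP.
  transitivity (phi5 n - 1 + n ^+ 5); first by rewrite /phi5; ring.
  by rewrite n0 n5; ring.
have [j + ->] := phi5_roots_Fp p_pr p_ge11 s0 n0; rewrite -exprM.
by case: j => [|[|[|[|[|j]]]]] // _; rewrite (phi5_mod _ s0) -/(eigen_pow _ 2) !inE !eqxx ?orbT.
Qed.

End FifthRoots.

Lemma maps_1_mod5 : (p %% 5 = 1)%N ->
  exists R1 R2 C1 C2 D1 D2 : oriented_map,
       [/\ classified (regular_map_of (- (2 * p ^ 2)%:Z)%R (10 * p ^ 2)) 10
             [:: R1; R2; C1; mirror C1; C2; mirror C2;
                 D1; mirror D1; D2; mirror D2],
           reflexive_map R1 /\ reflexive_map R2,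
           [/\ chiral_map C1, chiral_map C2, chiral_map D1 & chiral_map D2],
           forall k : 'Z_(p ^ 2), (5.-primitive_root k)%R ->
             [/\ presented_cyclic k (autp C1),
                 presented_cyclic k (autp (mirror C1)),
                 presented_cyclic k (autp C2)
               & presented_cyclic k (autp (mirror C2))]
         & forall s : 'F_p, (5.-primitive_root s)%R ->
             [/\ presented_split s 2 (autp D1),
                 presented_split s 2 (autp (mirror D1)),
                 presented_split s 2 (autp D2)
               & presented_split s 2 (autp (mirror D2))]
             /\ (presented_split s 4 (autp R1)
                 /\ presented_split s 4 (autp R2))].
Proof.
move=> p1; have [s s0] := exists_phi5_Fp p_pr p_ge11 p1.
have [k k0] := exists_phi5_Zp2 p_pr p_ge11 p1.
have adE i e : ~~ (5 %| i)%N -> e \in [:: 2; 4]%N -> admissible (eigen_pow s i e).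
  by move=> i5; apply: admissible_eigen; apply: phi5X.
have adC i : ~~ (5 %| i)%N -> admissible (cyc_pow k i) by move=> i5; apply: phi5X.
have [R1 hR1 dR1] := map_exists p_pr p_ge11 (adE 1%N 4%N isT isT).
have [R2 hR2 dR2] := map_exists p_pr p_ge11 (adE 2%N 4%N isT isT).
have [C1 hC1 dC1] := map_exists p_pr p_ge11 (adC 1%N isT).
have [C2 hC2 dC2] := map_exists p_pr p_ge11 (adC 2%N isT).
have [D1 hD1 dD1] := map_exists p_pr p_ge11 (adE 1%N 2%N isT isT).
have [D2 hD2 dD2] := map_exists p_pr p_ge11 (adE 2%N 2%N isT isT).
have mC i j M : (i + j = 5)%N -> regular_map10 p M -> map_realizes (cyc_pow k i) M ->
    map_realizes (cyc_pow k j) (mirror M).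
  move=> ij hM; apply: (realizes_cycV p_ge11 (map10_rot hM)).
  by rewrite -exprD ij phi5_expr5.
have mE i j M : (i + j = 5)%N -> regular_map10 p M -> map_realizes (eigen_pow s i 2) M ->
    map_realizes (eigen_pow s j 2) (mirror M).
  move=> ij hM dM; have xy : s ^+ i * s ^+ j = 1 by rewrite -exprD ij phi5_expr5.
  have nn : (s ^+ i) ^+ 3 * (s ^+ j) ^+ 3 = 1 by rewrite -exprMn xy expr1n.
  have := realizes_quadV p_pr (map10_rot hM) nn dM.
  rewrite (_ : (s ^+ i + s ^+ i ^+ 2) * (s ^+ j) ^+ 3 = s ^+ j + s ^+ j ^+ 2) //.
  transitivity (s ^+ i * s ^+ j * (s ^+ j) ^+ 2 + (s ^+ i * s ^+ j) ^+ 2 * s ^+ j); first by ring.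
  by rewrite xy; ring.
have cC1 := regular_map10_mirror hC1; have cC2 := regular_map10_mirror hC2.
have cD1 := regular_map10_mirror hD1; have cD2 := regular_map10_mirror hD2.
have dC1' := mC 1%N 4%N _ erefl hC1 dC1; have dC2' := mC 2%N 3%N _ erefl hC2 dC2.
have dD1' := mE 1%N 4%N _ erefl hD1 dD1; have dD2' := mE 2%N 3%N _ erefl hD2 dD2.
have ud := uniq_eigen_data s0 k0.
have chiral (d d' : datum p) M : regular_map10 p M -> map_realizes d M ->
    map_realizes d' (mirror M) -> d != d' -> chiral_map M.
  move=> hM dM dM' /eqP dd' /reflexive_mirror isoM; apply: dd'.
  have dM2 := map_iso_realizes isoM dM.
  exact: (map_realizes_inj p_pr p_ge11 (regular_map10_mirror hM) dM2 dM').
have nu i j : (i < j < 10)%N -> nth (cyc_pow k 0) (eigen_data s k) i != nth (cyc_pow k 0) (eigen_data s k) j.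
  by move=> /andP[ij j10]; rewrite nth_uniq ?ltn_eqF //= (ltn_trans ij).
exists R1, R2, C1, C2, D1, D2; split.
- apply: (@classified_data p p_pr p_ge11 (eigen_data s k) _ (cyc_pow k 0)) => //.
    by move=> M0 [|[|[|[|[|[|[|[|[|[|i]]]]]]]]]] // _; split.
  by move=> d; apply: mem_eigen_data.
- by split; [move: hR1 dR1|move: hR2 dR2]; rewrite eigen_pow4 //; apply: map10_reflexive.
- split.
  + exact: chiral hC1 dC1 dC1' (nu 2%N 3%N isT).
  + exact: chiral hC2 dC2 dC2' (nu 4%N 5%N isT).
  + exact: chiral hD1 dD1 dD1' (nu 6%N 7%N isT).
  exact: chiral hD2 dD2 dD2' (nu 8%N 9%N isT).
- move=> k' pk'; have ki i : ~~ (5 %| i)%N -> phi5 (k ^+ i) = 0 by apply: phi5X.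
  split.
  + exact: (map_cyc_presented p_pr p_ge11 (ki 1%N isT) pk' hC1 dC1).
  + exact: (map_cyc_presented p_pr p_ge11 (ki 4%N isT) pk' cC1 dC1').
  + exact: (map_cyc_presented p_pr p_ge11 (ki 2%N isT) pk' hC2 dC2).
  exact: (map_cyc_presented p_pr p_ge11 (ki 3%N isT) pk' cC2 dC2').
move=> s' ps'; have si i : ~~ (5 %| i)%N -> phi5 (s ^+ i) = 0 by apply: phi5X.
have pres i e M : ~~ (5 %| i)%N -> ~~ (5 %| e.-1)%N -> (0 < e)%N -> regular_map10 p M ->
    map_realizes (eigen_pow s i e) M -> presented_split s' e (autp M).
  move=> i5 e5 e0; exact: (map_eigen_presented p_pr p_ge11 (si i i5) e5 e0 ps').
split; first split.
- exact: pres hD1 dD1.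
- exact: pres cD1 dD1'.
- exact: pres hD2 dD2.
- exact: pres cD2 dD2'.
by split; [apply: pres hR1 dR1|apply: pres hR2 dR2].
Qed.

End Cases.

Theorem mainTheorem1 (p : nat) (p_pr : prime p) (p_ge11 : (11 <= p)%N) :
  ((p%:Z = -1 %[mod 5])%Z ->
     exists R1 R2 : oriented_map,
       [/\ classified (regular_map_of (- (2 * p ^ 2)%:Z)%R (10 * p ^ 2)) 2
             [:: R1; R2],
           reflexive_map R1, reflexive_map R2
         & forall t1 t2 : 'F_p,
             [set y : 'F_p | (y ^+ 2 + y - 1 == 0)%R] = [set t1; t2] ->
             presented_irreducible t1 t2 (autp R1)
             /\ presented_irreducible t1 t2 (autp R2)])
  /\
  ((p%:Z = 1 %[mod 5])%Z ->
     exists R1 R2 C1 C2 D1 D2 : oriented_map,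
       [/\ classified (regular_map_of (- (2 * p ^ 2)%:Z)%R (10 * p ^ 2)) 10
             [:: R1; R2; C1; mirror C1; C2; mirror C2;
                 D1; mirror D1; D2; mirror D2],
           reflexive_map R1 /\ reflexive_map R2,
           [/\ chiral_map C1, chiral_map C2, chiral_map D1 & chiral_map D2],
           forall k : 'Z_(p ^ 2), (5.-primitive_root k)%R ->
             [/\ presented_cyclic k (autp C1),
                 presented_cyclic k (autp (mirror C1)),
                 presented_cyclic k (autp C2)
               & presented_cyclic k (autp (mirror C2))]
         & forall s : 'F_p, (5.-primitive_root s)%R ->
             [/\ presented_split s 2 (autp D1),
                 presented_split s 2 (autp (mirror D1)),
                 presented_split s 2 (autp D2)
               & presented_split s 2 (autp (mirror D2))]
             /\ (presented_split s 4 (autp R1)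
                 /\ presented_split s 4 (autp R2))]).
Proof.
split=> pmod.
  by apply: maps_minus1_mod5 => //; lia.
by apply: maps_1_mod5 => //; lia.
Qed.
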